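(* Let $(M,g,Z,\mu)$ be a Ricci soliton with potential vector field $Z\in\Gamma((\mathrm{Ker}F_\ast)^\perp)$, where $F:(M^m,g)\to(N^n,h)$ is a totally geodesic horizontally conformal submersion from the Riemannian manifold $M$ to a connected Einstein manifold $N$, and $Z$ is the horizontal lift of a vector field $\tilde Z$ on $N$. Then $\tilde Z$ is a conformal vector field on $N$.
   Context: A Ricci soliton $(M,g,\xi,\mu)$ is a Riemannian manifold $(M,g)$ with a smooth vector field $\xi$ (the potential vector field) and a constant $\mu\in\mathbb{R}$ such that $\frac12L_\xi g+\mathrm{Ric}+\mu g=0$, where $L_\xi g$ is the Lie derivative of $g$ and $\mathrm{Ric}$ the Ricci tensor. A horizontally conformal submersion with dilation $\lambda$ is a surjective smooth submersion $F:(M,g)\to(N,h)$ between Riemannian manifolds together with a smooth function $\lambda:M\to\mathbb{R}^+$ such that $h(F_\ast X,F_\ast Y)=\lambda^2(p)\,g(X,Y)$ for all $p\in M$ and all $X,Y\in(\mathrm{Ker}F_{\ast p})^\perp$. $F$ is totally geodesic if its second fundamental form $(\nabla F_\ast)(X,Y)=\nabla^F_XF_\ast Y-F_\ast(\nabla_XY)$ vanishes for all $X,Y\in\Gamma(TM)$, where $\nabla$ is the Levi-Civita connection of $g$ and $\nabla^F$ the pullback to $F^{-1}TN$ of the Levi-Civita connection of $h$. The horizontal lift of a vector field $\tilde Z$ on $N$ is the unique section $Z$ of the horizontal distribution $(\mathrm{Ker}F_\ast)^\perp$ with $F_\ast Z=\tilde Z\circ F$. A vector field $\xi$ on a Riemannian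 manifold $(N,h)$ is conformal if $L_\xi h=2fh$ for a smooth function $f$ on $N$. *)

(* Defs.v *)
From HB Require Import structures.
From mathcomp Require Import all_boot all_order all_algebra.
From mathcomp Require Import all_classical all_reals all_analysis.
From mathcomp Require Import ring.

Set Implicit Arguments.
Unset Strict Implicit.
Unset Printing Implicit Defensive.

Import Order.TTheory GRing.Theory Num.Theory.
Import numFieldNormedType.Exports.

Local Open Scope classical_set_scope.
Local Open Scope ring_scope.

Section Smooth.
Context {R : realType} {V W : normedModType R}.

(* Fréchet differentiability, and not only the existence of directional
   derivatives, is required at every order. The set U is meant to be open. *)
Fixpoint Ck (k : nat) (U : set V) (f : V -> W) : Prop :=
  match k with
  | 0%N => forall x, U x -> {for x, continuous f}
  | k'.+1 => (forall x, U x -> differentiable f x) /\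
             (forall v, Ck k' U ('D_v f))
  end.

Definition smooth_on (U : set V) (f : V -> W) : Prop := forall k, Ck k U f.

End Smooth.

(* A smooth atlas, not necessarily maximal, on a Hausdorff second countable
   space. The maps [cmap i] and [cinv i] are total; their values matter only on
   [cdom i] and on [cmap i @` cdom i]. *)
Record manifold (R : realType) (n : nat) := Manifold {
  msort :> topologicalType ;
  manifold_hausdorff : hausdorff_space msort ;
  manifold_countable : @second_countable msort ;
  chart : Type ;
  cdom : chart -> set msort ;
  cmap : chart -> msort -> 'rV[R]_n ;
  cinv : chart -> 'rV[R]_n -> msort ;
  cdom_open : forall i, open (cdom i) ;
  cdom_cover : forall p, exists i, cdom i p ;
  cmap_open : forall i, open (cmap i @` cdom i) ;
  cmapK : forall i p, cdom i p -> cinv i (cmap i p) = p ;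
  cmap_continuous : forall i p, cdom i p -> {for p, continuous (cmap i)} ;
  cinv_continuous : forall i x, (cmap i @` cdom i) x ->
    {for x, continuous (cinv i)} ;
  transition_smooth : forall i j,
    smooth_on (cmap i @` (cdom i `&` cdom j)) (cmap j \o cinv i) }.

Arguments chart {R n} m.
Arguments cdom {R n m} i _.
Arguments cmap {R n m} i _.
Arguments cinv {R n m} i _.

(* ∂f/∂x^a at p, in the coordinates x of the chart i. *)
Definition pd (R : realType) (n : nat) (M : manifold R n) (i : chart M)
    (a : 'I_n) (f : M -> R) (p : M) : R :=
  'D_(delta_mx 0 a) (f \o cinv i : 'rV[R]_n -> R) (cmap i p).

(* Tangent vectors are written as row vectors of coordinates, so the
   differential of F acts on them by right multiplication by [jac F]. *)
Definition jac (R : realType) (m n : nat) (M : manifold R m)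
    (N : manifold R n) (F : M -> N) (i : chart M) (j : chart N) (p : M) :
    'M[R]_(m, n) :=
  \matrix_(a, b) pd i a (fun q => cmap j (F q) 0 b) p.

Definition smooth_fun (R : realType) (n : nat) (M : manifold R n)
    (f : M -> R) : Prop :=
  forall i : chart M,
    smooth_on (cmap i @` cdom i) (f \o cinv i : 'rV[R]_n -> R).

Definition smooth_map (R : realType) (m n : nat) (M : manifold R m)
    (N : manifold R n) (F : M -> N) : Prop :=
  continuous F /\
  forall (i : chart M) (j : chart N),
    smooth_on (cmap i @` (cdom i `&` F @^-1` cdom j)) (cmap j \o F \o cinv i).

(* [X i p] is the row of components of the field at p in the chart i; it is
   unconstrained when p is outside [cdom i]. *)
Record vfield (R : realType) (n : nat) (M : manifold R n) := VField {
  vcomp :> chart M -> M -> 'rV[R]_n ;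
  vcomp_smooth : forall i, smooth_on (cmap i @` cdom i) (vcomp i \o cinv i) ;
  vcomp_change : forall i j p, cdom i p -> cdom j p ->
    vcomp j p = vcomp i p *m jac (@id M) i j p }.

Record metric (R : realType) (n : nat) (M : manifold R n) := Metric {
  gcomp :> chart M -> M -> 'M[R]_n ;
  gcomp_smooth : forall i, smooth_on (cmap i @` cdom i) (gcomp i \o cinv i) ;
  gcomp_sym : forall i p, cdom i p -> (gcomp i p)^T = gcomp i p ;
  gcomp_pos : forall i p, cdom i p -> forall x : 'rV[R]_n, x != 0 ->
    0 < (x *m gcomp i p *m x^T) 0 0 ;
  gcomp_change : forall i j p, cdom i p -> cdom j p ->
    gcomp i p =
      jac (@id M) i j p *m gcomp j p *m (jac (@id M) i j p)^T }.

(* In this section fields are given by their components in the fixed chart i. *)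
Section Riemannian.
Context {R : realType} {n : nat} {M : manifold R n}.
Variables (g : metric M) (i : chart M).
Implicit Types (X Y W : M -> 'rV[R]_n) (f : M -> R) (p : M).

Definition dirderiv X f p : R := \sum_a X p 0 a * pd i a f p.

Definition bracket X Y p : 'rV[R]_n :=
  \row_c (dirderiv X (fun q => Y q 0 c) p - dirderiv Y (fun q => X q 0 c) p).

Definition frame (a : 'I_n) : M -> 'rV[R]_n := fun=> delta_mx 0 a.

Definition ginner X Y p : R := (X p *m g i p *m (Y p)^T) 0 0.

(* Γ^c_{ab} = (1/2) g^{cd} (∂_a g_{bd} + ∂_b g_{ad} - ∂_d g_{ab}) *)
Definition christoffel (a b c : 'I_n) p : R :=
  2^-1 * \sum_d invmx (g i p) c d *
    (pd i a (fun q => g i q b d) p + pd i b (fun q => g i q a d) p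
     - pd i d (fun q => g i q a b) p).

(* The Levi-Civita connection. *)
Definition nabla X Y p : 'rV[R]_n :=
  \row_c (dirderiv X (fun q => Y q 0 c) p
          + \sum_a \sum_b christoffel a b c p * X p 0 a * Y p 0 b).

Definition riem X Y W p : 'rV[R]_n :=
  nabla X (nabla Y W) p - nabla Y (nabla X W) p - nabla (bracket X Y) W p.

(* Ric(Y, W) is the trace of X |-> R(X, Y)W. *)
Definition ricci p : 'M[R]_n :=
  \matrix_(b, c) \sum_a riem (frame a) (frame b) (frame c) p 0 a.

Definition lie_metric X p : 'M[R]_n :=
  \matrix_(a, b) (dirderiv X (ginner (frame a) (frame b)) p
                  - ginner (bracket X (frame a)) (frame b) p
                  - ginner (frame a) (bracket X (frame b)) p).

(* [nabla] is torsion free and compatible with the metric. *)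

Lemma gcomp_unit p : cdom i p -> g i p \in unitmx.
Proof.
move=> ip; rewrite -row_free_unit -kermx_eq0; apply/rowV0P => x.
move/sub_kermxP => xg; apply/eqP; apply: contraT => x0.
by have := gcomp_pos g ip x0; rewrite xg mul0mx mxE ltxx.
Qed.

Lemma gcomp_symE p (a b : 'I_n) : cdom i p -> g i p a b = g i p b a.
Proof. by move=> ip; rewrite -[in LHS](gcomp_sym g ip) mxE. Qed.

Lemma pd_gcomp_sym p (a b c : 'I_n) : cdom i p ->
  pd i c (fun q => g i q a b) p = pd i c (fun q => g i q b a) p.
Proof.
move=> ip; rewrite /pd; apply: near_eq_derive.
have : nbhs (cmap i p) (cmap i @` cdom i).
  by apply: open_nbhs_nbhs; split; [exact: cmap_open|exists p].
apply: filterS => x [q iq <-] /=; rewrite cmapK//; exact: gcomp_symE.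
Qed.

Lemma christoffel_sym p (a b c : 'I_n) : cdom i p ->
  christoffel a b c p = christoffel b a c p.
Proof.
move=> ip; rewrite /christoffel; congr (_ * _); apply: eq_bigr => d _.
by rewrite (pd_gcomp_sym a b d ip) [in LHS](addrC (pd i a _ _)).
Qed.

Lemma nabla_torsion_free X Y p : cdom i p ->
  nabla X Y p - nabla Y X p = bracket X Y p.
Proof.
move=> ip; apply/rowP => c; rewrite !mxE opprD addrACA -[RHS]addr0.
congr (_ + _); apply/eqP; rewrite subr_eq0 exchange_big /=; apply/eqP.
apply: eq_bigr => a _; apply: eq_bigr => b _.
by rewrite (christoffel_sym _ _ _ ip) -!mulrA [X p 0 b * _]mulrC.
Qed.

Lemma nabla_metric p (a b c : 'I_n) : cdom i p ->
  pd i a (fun q => g i q b c) p =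
    ginner (nabla (frame a) (frame b)) (frame c) p
    + ginner (frame b) (nabla (frame a) (frame c)) p.
Proof.
move=> ip.
have nablaE (u v w : 'I_n) :
    nabla (frame u) (frame v) p 0 w = christoffel u v w p.
  rewrite mxE [X in X + _]big1 ?add0r; last first.
    move=> d _; rewrite /pd (_ : _ \o _ = cst (frame v p 0 w)) ?derive_cst//.
    exact: mulr0.
  rewrite (bigD1 u)//= [X in _ + X]big1 ?addr0; last first.
    move=> d du; apply: big1 => e _.
    by rewrite /frame !mxE !eqxx (negPf du) mulr0 mul0r.
  rewrite (bigD1 v)//= [X in _ + X]big1 ?addr0; last first.
    by move=> e ev; rewrite /frame !mxE !eqxx (negPf ev) mulr0.
  by rewrite /frame !mxE !eqxx !mulr1.
pose k (u v w : 'I_n) : R := 2^-1 *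
  (pd i u (fun q => g i q v w) p + pd i v (fun q => g i q u w) p
   - pd i w (fun q => g i q u v) p).
have gE (u v w : 'I_n) : (nabla (frame u) (frame v) p *m g i p) 0 w = k u v w.
  suff -> : nabla (frame u) (frame v) p = (\row_d k u v d) *m invmx (g i p).
    by rewrite mulmxKV ?gcomp_unit// mxE.
  apply/rowP => e; rewrite nablaE mxE /christoffel mulr_sumr.
  apply: eq_bigr => d _; rewrite !mxE mulrCA mulrC /k; congr (_ * _).
  have invg : (invmx (g i p))^T = invmx (g i p).
    by rewrite trmx_inv gcomp_sym.
  by rewrite -[in LHS]invg mxE.
have frameE (x : 'rV[R]_n) (w : 'I_n) : (x *m (frame w p)^T) 0 0 = x 0 w.
  by rewrite /frame trmx_delta -colE mxE.
have -> : ginner (frame b) (nabla (frame a) (frame c)) p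
    = ginner (nabla (frame a) (frame c)) (frame b) p.
  rewrite /ginner -[LHS]trace_mx11 -mxtrace_tr trace_mx11.
  by rewrite !trmx_mul trmxK gcomp_sym// mulmxA.
rewrite /ginner !frameE !gE /k -mulrDr (pd_gcomp_sym c b a ip).
by move: (pd i a _ p) (pd i b _ p) (pd i c _ p) => x y z; field.
Qed.

End Riemannian.

Section Submersion.
Context {R : realType} {m n : nat} {M : manifold R m} {N : manifold R n}.
Variables (g : metric M) (h : metric N) (F : M -> N).
Implicit Types (i : chart M) (j : chart N) (p : M).

(* Components of the section F_*X of F^{-1}TN. *)
Definition pushfwd i j (X : M -> 'rV[R]_m) p : 'rV[R]_n :=
  X p *m jac F i j p.

(* The pullback to F^{-1}TN of the Levi-Civita connection of h, applied to the
   section with components V. *)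
Definition nabla_pullback i j (X : M -> 'rV[R]_m) (V : M -> 'rV[R]_n) p :
    'rV[R]_n :=
  \row_c (dirderiv i X (fun q => V q 0 c) p
          + \sum_a \sum_b christoffel h j a b c (F p)
                          * pushfwd i j X p 0 a * V p 0 b).

Definition second_fundamental_form i j (X Y : M -> 'rV[R]_m) p : 'rV[R]_n :=
  nabla_pullback i j X (pushfwd i j Y) p - pushfwd i j (nabla g i X Y) p.

Definition totally_geodesic : Prop :=
  forall (X Y : vfield M) i j p, cdom i p -> cdom j (F p) ->
    second_fundamental_form i j (X i) (Y i) p = 0.

(* x is the row of components at p of a vector of (Ker dF)^⊥. *)
Definition horizontal i j p (x : 'rV[R]_m) : Prop :=
  forall v : 'rV[R]_m, v *m jac F i j p = 0 -> x *m g i p *m v^T = 0.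

Definition submersion : Prop :=
  smooth_map F /\
  forall i j p, cdom i p -> cdom j (F p) -> row_full (jac F i j p).

Definition horizontally_conformal_submersion (lambda : M -> R) : Prop :=
  [/\ submersion,
      forall q : N, exists p : M, F p = q,
      smooth_fun lambda,
      forall p, 0 < lambda p &
      forall i j p, cdom i p -> cdom j (F p) ->
        forall x y : 'rV[R]_m, horizontal i j p x -> horizontal i j p y ->
        x *m jac F i j p *m h j (F p) *m (y *m jac F i j p)^T =
          lambda p ^+ 2 *: (x *m g i p *m y^T)].

Definition horizontal_field (Z : vfield M) : Prop :=
  forall i j p, cdom i p -> cdom j (F p) -> horizontal i j p (Z i p).

Definition horizontal_lift (Z : vfield M) (Zt : vfield N) : Prop :=
  horizontal_field Z /\
  forall i j p, cdom i p -> cdom j (F p) ->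
    pushfwd i j (Z i) p = Zt j (F p).

End Submersion.

Definition ricci_soliton (R : realType) (n : nat) (M : manifold R n)
    (g : metric M) (xi : vfield M) (mu : R) : Prop :=
  forall (i : chart M) (p : M), cdom i p ->
    2^-1 *: lie_metric g i (xi i) p + ricci g i p + mu *: g i p = 0.

Definition einstein (R : realType) (n : nat) (N : manifold R n)
    (h : metric N) : Prop :=
  exists c : R, forall (j : chart N) (q : N), cdom j q ->
    ricci h j q = c *: h j q.

Definition conformal_field (R : realType) (n : nat) (N : manifold R n)
    (h : metric N) (xi : vfield N) : Prop :=
  exists f : N -> R, smooth_fun f /\
    forall (j : chart N) (q : N), cdom j q ->
      lie_metric h j (xi j) q = (2 * f q) *: h j q.

(* Main.v *)
Require Import Defs.
From mathcomp Require Import all_boot all_order all_algebra.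
From mathcomp Require Import all_classical all_reals all_analysis.
From mathcomp Require Import ring.

Set Implicit Arguments.
Unset Strict Implicit.
Unset Printing Implicit Defensive.

Import Order.TTheory GRing.Theory Num.Theory.
Import numFieldNormedType.Exports.

Local Open Scope classical_set_scope.
Local Open Scope ring_scope.

(** Write vectors as rows of components, J for the matrix of dF, g and h for the
matrices of the two metrics, G for the inverse of g.

A totally geodesic F has a parallel differential: in coordinates
dJ = Γ J - J Ω, where Γ is the connection of M and Ω the pullback by F of that
of N ([dmx_jac]). Differentiating this once more and using the symmetry of second
derivatives, dF intertwines the curvatures: R^M(X,Y) J = J R^N(F_*X, F_*Y)
([curvature_jac]). Differentiating F_*Z = Zt o F shows likewise that ∇Z lies
over ∇Zt ([covariant_diff_lift]).

Horizontal vectors are the images of the adjoint of dF, so that horizontal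
conformality says J^T G J h = λ² ([adjoint_conformal]). Therefore
S = λ^-2 h J^T G is the matrix of the horizontal lift: S J = 1 and
S g S^T = λ^-2 h. Curvature endomorphisms are skew-adjoint, and transposing
R^M J = J R^N gives S R^M = R^N S ([lift_mx_skew]). Taking traces,
Ric^M(SX, SY) = Ric^N(X, Y) ([lift_mx_ricci]). As L_Z g is twice the symmetric
part of g(∇Z, .), one has also (L_Z g)(SX, SY) = λ^-2 (L_Zt h)(X, Y)
([lift_mx_lie]).

If Ric^N = c h, the soliton equation evaluated on horizontal lifts becomes
1/2 λ^-2 L_Zt h + c h + μ λ^-2 h = 0, that is L_Zt h = -2 (c λ² + μ) h
([lie_metric_lift]). The factor at a point of N is read off at a point of its
fibre; it is smooth because it is a quotient of components of the smooth tensors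
L_Zt h and h ([conformal_factor_smooth]).

The second fundamental form is evaluated on globally defined fields only,
whereas the computation takes place in charts. The coordinate frame at a point is
therefore extended to M by means of a bump function ([vfield_through]), which is
the reason for the calculus of C^k functions and for the function exp(-1/t). *)

(** * Functions of class C^k between normed spaces *)

Lemma near_eq_differentiable (R : realType) (V W : normedModType R)
    (f g : V -> W) (x : V) :
  (\near x, f x = g x) -> differentiable f x -> differentiable g x.
Proof.
move=> fg df.
suff dgf : differentiable (g - f) x.
  by rewrite -(subrK f g); exact: differentiableD.
have e : (g - f) \o shift x = cst ((g - f) x) + (0 : V -> W) +o_ 0 id.
  apply/eqaddoP => _/posnumP[e].
  have : \forall y \near 0, f (y + x) = g (y + x).
    by move: fg; rewrite (near_shift 0) /= subr0.
  apply: filterS => y fgy.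
  rewrite !fctE /= fgy (nbhs_singleton fg) !subrr addr0 subr0 normr0.
  by rewrite mulr_ge0.
apply/diff_locallyP.
have c0 : continuous (0 : V -> W) by move=> y; exact: cst_continuous.
by rewrite (diff_unique c0 e).
Qed.

Section Ck_calculus.
Context {R : realType}.
Implicit Types (V W : normedModType R).

Lemma Ck_ext k V W (U : set V) (f g : V -> W) : open U ->
  (forall x, U x -> f x = g x) -> Ck k U f -> Ck k U g.
Proof.
move=> oU; elim: k f g => [|k IH] f g fg /=.
  move=> cf x Ux; have := cf x Ux.
  rewrite /prop_for /continuous_at -(fg _ Ux) => h.
  apply: cvg_trans h; apply: near_eq_cvg.
  by have := open_nbhs_nbhs (conj oU Ux); apply: filterS => y /fg.
have nfg x : U x -> \near x, f x = g x.
  by move=> Ux; have := open_nbhs_nbhs (conj oU Ux); apply: filterS => y /fg.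
case=> df Df; split=> [x Ux|v].
  exact: near_eq_differentiable (nfg _ Ux) (df x Ux).
by apply: IH (Df v) => x Ux; apply: near_eq_derive; exact: nfg.
Qed.

Lemma CkW k V W (U : set V) (f : V -> W) : Ck k.+1 U f -> Ck k U f.
Proof.
elim: k f => [|k IH] f [df Df].
  by move=> x Ux; exact/differentiable_continuous/df.
by split=> // v; exact: IH.
Qed.

Lemma CkS k V W (U U' : set V) (f : V -> W) :
  U' `<=` U -> Ck k U f -> Ck k U' f.
Proof.
move=> UU'; elim: k f => [|k IH] f /=.
  by move=> cf x U'x; apply: cf; exact: UU'.
case=> df Df; split=> [x U'x|v]; last exact: IH (Df v).
by apply: df; exact: UU'.
Qed.

Lemma Ck_local k V W (U : set V) (f : V -> W) :
  (forall x, U x -> exists2 U', U' x & Ck k U' f) -> Ck k U f.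
Proof.
elim: k f => [|k IH] f h /=.
  by move=> x Ux; have [U' U'x] := h x Ux; apply.
split=> [x Ux|v]; first by have [U' U'x [df _]] := h x Ux; exact: df.
by apply: IH => x Ux; have [U' U'x [_ Df]] := h x Ux; exists U'; last exact: Df.
Qed.

Lemma Ck_cst k V W (U : set V) (c : W) : Ck k U (cst c : V -> W).
Proof.
elim: k c => [|k IH] c /=; first by move=> x _; exact: cst_continuous.
split=> [x _|v]; first exact: differentiable_cst.
rewrite (_ : 'D_v (cst c) = cst 0) //; apply/funext => x; exact: derive_cst.
Qed.

Lemma CkD k V W (U : set V) (f g : V -> W) : open U ->
  Ck k U f -> Ck k U g -> Ck k U (f + g).
Proof.
move=> oU; elim: k f g => [|k IH] f g /=.
  by move=> cf cg x Ux; apply: continuousD; [exact: cf|exact: cg].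
case=> df Df [dg Dg]; split=> [x Ux|v].
  by apply: differentiableD; [exact: df|exact: dg].
apply: Ck_ext (IH _ _ (Df v) (Dg v)) => // x Ux.
by rewrite deriveD//; apply: diff_derivable; [exact: df|exact: dg].
Qed.

Lemma CkN k V W (U : set V) (f : V -> W) : open U ->
  Ck k U f -> Ck k U (- f).
Proof.
move=> oU; elim: k f => [|k IH] f /=.
  by move=> cf x Ux; apply: continuousN; exact: cf.
case=> df Df; split=> [x Ux|v]; first exact/differentiableN/df.
apply: Ck_ext (IH _ (Df v)) => // x Ux.
by rewrite deriveN//; exact/diff_derivable/df.
Qed.

Lemma CkB k V W (U : set V) (f g : V -> W) : open U ->
  Ck k U f -> Ck k U g -> Ck k U (f - g).
Proof. by move=> oU Cf Cg; apply: CkD => //; exact: CkN. Qed.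

Lemma Ck_id k V (U : set V) : Ck k U (id : V -> V).
Proof.
case: k => [|k]; first by move=> x _; exact: cvg_id.
split=> [x _|v]; first exact: ex_diff.
rewrite (_ : 'D_v id = cst v); first exact: Ck_cst.
by apply/funext => x; exact: derive_id.
Qed.

Lemma Ck_sum k V W (U : set V) (I : Type) (r : seq I) (P : pred I)
    (f : I -> V -> W) : open U ->
  (forall i, P i -> Ck k U (f i)) -> Ck k U (\sum_(i <- r | P i) f i).
Proof.
by move=> oU h; apply: big_ind => //; [exact: Ck_cst|move=> *; exact: CkD].
Qed.

Lemma CkM k V (U : set V) (f g : V -> R) : open U ->
  Ck k U f -> Ck k U g -> Ck k U (f * g).
Proof.
move=> oU; elim: k f g => [|k IH] f g.
  by move=> cf cg x Ux; apply: continuousM; [exact: cf|exact: cg].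
move=> Cf Cg; have Cf' := CkW Cf; have Cg' := CkW Cg.
case: Cf Cg => df Df [dg Dg]; split=> [x Ux|v].
  by apply: differentiableM; [exact: df|exact: dg].
apply: Ck_ext (CkD oU (IH _ _ Cf' (Dg v)) (IH _ _ Cg' (Df v))) => // x Ux.
by rewrite deriveM//; apply: diff_derivable; [exact: df|exact: dg].
Qed.

Lemma CkV k V (U : set V) (f : V -> R) : open U ->
  (forall x, U x -> f x != 0) -> Ck k U f -> Ck k U (fun x => (f x)^-1).
Proof.
move=> oU f0; elim: k => [|k IH].
  by move=> cf x Ux; apply: continuousV; [exact: f0|exact: cf].
move=> Cf; have := IH (CkW Cf); case: Cf => df Df CV; split=> [x Ux|v].
  by apply: differentiableV; [exact: df|exact: f0].
have C1 := CkM oU (CkM oU CV CV) (Df v).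
have C2 : Ck k U (cst (-1) * ((fun x => (f x)^-1) * (fun x => (f x)^-1)
    * 'D_v f)) by apply: CkM => //; exact: Ck_cst.
apply: Ck_ext C2 => // x Ux.
rewrite deriveV; [|exact: f0|exact/diff_derivable/df].
by rewrite !fctE expr2 invfM /GRing.scale/= mulN1r mulNr.
Qed.

Lemma CkZl k V W (U : set V) (f : V -> R) (w : W) : open U ->
  Ck k U f -> Ck k U (fun x => f x *: w).
Proof.
move=> oU; elim: k f => [|k IH] f.
  by move=> cf x Ux; apply: continuousZr_tmp; exact: cf.
case=> df Df; split=> [x Ux|v]; first exact/differentiableZl/df.
apply: Ck_ext (IH _ (Df v)) => // x Ux.
have dfx := df x Ux.
rewrite [RHS]deriveE; last exact: differentiableZl.
by rewrite diffZl//= deriveE.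
Qed.

Lemma Ck_coord k V m n (U : set V) (f : V -> 'M[R]_(m, n)) i j : open U ->
  Ck k U f -> Ck k U (fun x => f x i j).
Proof.
move=> oU; elim: k f => [|k IH] f.
  move=> cf x Ux.
  apply: (@continuous_comp _ _ _ f (fun A : 'M[R]_(_, _) => A i j)).
    exact: cf.
  exact: coord_continuous.
case=> df Df; split=> [x Ux|v].
  apply: (@differentiable_comp _ _ _ _ f (fun A : 'M[R]_(_, _) => A i j)).
    exact: df.
  exact: differentiable_coord.
apply: Ck_ext (IH _ (Df v)) => // x Ux.
by rewrite derive_mx ?mxE//; apply/diff_derivable/df.
Qed.

Lemma Ck_mx k V m n (U : set V) (f : V -> 'M[R]_(m, n)) : open U ->
  (forall i j, Ck k U (fun x => f x i j)) -> Ck k U f.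
Proof.
move=> oU Cf.
have C : Ck k U (\sum_i \sum_j (fun x => f x i j *: delta_mx i j)).
  by do 2![apply: Ck_sum => // ? _]; apply: CkZl.
apply: Ck_ext C => // x _; rewrite [RHS]matrix_sum_delta fct_sumE.
by apply: eq_bigr => i _; rewrite fct_sumE.
Qed.

(** The chain rule expands the derivative of a composite along the coordinate
directions of the intermediate space into a sum of products of functions of the
same kind, which is what makes the induction on the order go through. *)
Lemma derive_comp_row V n (u : 'rV[R]_n -> R) (f : V -> 'rV[R]_n) x v :
  differentiable f x -> differentiable u (f x) ->
  'D_v (u \o f) x =
  \sum_a 'D_v (fun y => f y 0 a) x * 'D_(delta_mx 0 a) u (f x).
Proof.
move=> df du; rewrite deriveE; last exact: differentiable_comp.
rewrite diff_comp//= -(deriveE v df) derive_mx; last exact: diff_derivable.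
rewrite [X in 'd _ _ X]row_sum_delta linear_sum/=.
by apply: eq_bigr => a _; rewrite linearZ/= mxE -deriveE.
Qed.

Lemma Ck_comp k V n (U : set V) (U' : set 'rV[R]_n) (u : 'rV[R]_n -> R)
    (f : V -> 'rV[R]_n) : open U -> (forall x, U x -> U' (f x)) ->
  Ck k U' u -> Ck k U f -> Ck k U (u \o f).
Proof.
move=> oU UU'; elim: k u => [|k IH] u.
  by move=> cu cf x Ux; apply: continuous_comp; [exact: cf|exact/cu/UU'].
move=> Cu Cf; have Cf' := CkW Cf.
case: Cu Cf => du Du [df Df]; split=> [x Ux|v].
  by apply: differentiable_comp; [exact: df|exact/du/UU'].
have C : Ck k U (\sum_a (fun x => 'D_v f x 0 a) * ('D_(delta_mx 0 a) u \o f)).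
  apply: Ck_sum => // a _; apply: CkM => //; last exact: IH (Du _) Cf'.
  by apply: Ck_coord => //; exact: Df.
apply: Ck_ext C => // x Ux.
rewrite derive_comp_row ?fct_sumE; [|exact: df|exact/du/UU'].
apply: eq_bigr => a _; rewrite mulrfctE /=.
by rewrite (derive_mx (diff_derivable (df x Ux))) mxE.
Qed.

End Ck_calculus.

(** * Symmetry of second derivatives *)

Section Schwarz.
Context {R : realType} {V : normedModType R}.

Lemma is_derive_line (f : V -> R) (x v : V) (s : R) :
  differentiable f (x + s *: v) ->
  is_derive s 1 (fun r : R => f (x + r *: v)) ('D_v f (x + s *: v)).
Proof.
move=> df.
have dl : is_diff s (fun r : R => x + r *: v) (fun r : R => r *: v).
  by apply: is_diff_eq; rewrite add0r.
have dc : differentiable (f \o (fun r : R => x + r *: v)) s.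
  by apply: differentiable_comp => //; exact: ex_diff.
apply: DeriveDef; first exact: diff_derivable.
rewrite deriveE// diff_comp; [|exact: ex_diff|exact: df].
by rewrite /= diff_val scale1r deriveE.
Qed.

Lemma derive_shift_arg (f : V -> R) (x u v : V) :
  'D_v (fun y => f (y + u)) x = 'D_v f (x + u).
Proof.
rewrite /derive; set a := (X in X @ _); set b := (X in _ = lim (X @ _)).
suff -> : a = b by [].
by apply/funext => h; rewrite /a /b /= addrA.
Qed.

Lemma MVT_line (f : V -> R) (x v : V) (t : R) : 0 < t ->
  (forall s, 0 <= s <= t -> differentiable f (x + s *: v)) ->
  exists2 s, 0 <= s <= t & f (x + t *: v) - f x = t * 'D_v f (x + s *: v).
Proof.
move=> t0 df.
have [||s] := @MVT R (fun r => f (x + r *: v)) (fun r => 'D_v f (x + r *: v))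
   0 t t0.
- move=> s /[!in_itv]/= /andP[s0 st]; apply: is_derive_line.
  by apply: df; rewrite !ltW.
- apply: derivable_within_continuous => s /[!in_itv]/= h.
  by have [] := is_derive_line (df _ h).
move=> /[!in_itv]/= /andP[s0 st] E; exists s; first by rewrite !ltW.
by move: E; rewrite scale0r addr0 subr0 mulrC.
Qed.

(** The mean value theorem, first along v and then along w. *)
Lemma second_difference (U : set V) (f : V -> R) (x v w : V) (t : R) : 0 < t ->
  (forall y, U y -> differentiable f y) ->
  (forall y, U y -> differentiable ('D_v f) y) ->
  (forall r s : R, 0 <= r <= t -> 0 <= s <= t -> U (x + r *: v + s *: w)) ->
  exists r s : R, [/\ 0 <= r <= t, 0 <= s <= t &
    f (x + t *: v + t *: w) - f (x + t *: v) - (f (x + t *: w) - f x)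
    = t * (t * 'D_w ('D_v f) (x + r *: v + s *: w))].
Proof.
move=> t0 df dDf Ut; have t0t : 0 <= t <= t by rewrite lexx ltW.
have zt : 0 <= (0 : R) <= t by rewrite lexx ltW.
have Ur (r : R) : 0 <= r <= t -> U (x + r *: v).
  by move=> rt; have := Ut r 0 rt zt; rewrite scale0r addr0.
pose fT y := f (y + t *: w).
have dT (r : R) : 0 <= r <= t -> differentiable fT (x + r *: v).
  move=> rt.
  apply: (@differentiable_comp _ _ _ _ (fun y => y + t *: w) f) => //.
  by apply: df; exact: Ut.
have d1 (r : R) : 0 <= r <= t -> differentiable (fT - f) (x + r *: v).
  by move=> rt; apply: differentiableB; [exact: dT|exact/df/Ur].
have [r rt E] := MVT_line t0 d1.
have d2 (s : R) : 0 <= s <= t -> differentiable ('D_v f) (x + r *: v + s *: w).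
  by move=> st; apply: dDf; exact: Ut.
have [s st E'] := MVT_line t0 d2.
exists r, s; split=> //; rewrite -E'.
have DB : 'D_v (fT - f) (x + r *: v) =
    'D_v fT (x + r *: v) - 'D_v f (x + r *: v).
  by apply: deriveB; apply: diff_derivable; [exact: dT|exact/df/Ur].
rewrite DB /fT derive_shift_arg in E.
exact: E.
Qed.

(** The second difference of f along v and w, divided by t², is a value of a at
distance O(t) from x. *)
Let second_quotient (U : set V) (f : V -> R) (x v w : V) (a : V -> R) :=
  forall t : R, 0 < t ->
  (forall r s : R, 0 <= r <= t -> 0 <= s <= t -> U (x + r *: v + s *: w)) ->
  exists r s : R, [/\ 0 <= r <= t, 0 <= s <= t &
    f (x + t *: v + t *: w) - f (x + t *: v) - (f (x + t *: w) - f x)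
    = t * (t * a (x + r *: v + s *: w))].

Lemma second_difference_limit (U : set V) (f a b : V -> R) (x v w : V) :
  open U -> U x -> {for x, continuous a} -> {for x, continuous b} ->
  second_quotient U f x v w b -> second_quotient U f x w v a -> a x = b x.
Proof.
move=> oU Ux ca cb Svw Swv.
have close (e : R) : 0 < e -> `|a x - b x| <= e + e.
  move=> e0.
  pose A := [set y | [/\ U y, `|a x - a y| < e & `|b x - b y| < e]].
  have : nbhs x A.
    have /cvgrPdist_lt/(_ _ e0) n1 := ca.
    have /cvgrPdist_lt/(_ _ e0) n2 := cb.
    have n3 := open_nbhs_nbhs (conj oU Ux).
    by near=> y; split; near: y.
  move=> /nbhs_ballP[d /= d0 dA].
  pose t := d / (`|v| + `|w| + 1).
  have c0 : 0 < `|v| + `|w| + 1 by rewrite ltr_wpDl// addr_ge0.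
  have t0 : 0 < t by rewrite divr_gt0.
  have At (r s : R) : 0 <= r <= t -> 0 <= s <= t -> A (x + r *: v + s *: w).
    move=> /andP[r0 rt] /andP[s0 st]; apply: dA.
    rewrite -ball_normE /= -addrA opprD addNKr normrN.
    rewrite (le_lt_trans (ler_normD _ _))// !normrZ !ger0_norm//.
    rewrite (@le_lt_trans _ _ (t * `|v| + t * `|w|))//.
      by rewrite lerD// ler_wpM2r.
    rewrite -mulrDr -[X in _ < X](divfK (lt0r_neq0 c0)) -/t ltr_pM2l//.
    by rewrite ltrDl.
  have Uvw (r s : R) : 0 <= r <= t -> 0 <= s <= t -> U (x + r *: v + s *: w).
    by move=> rt st; have [] := At r s rt st.
  have Uwv (r s : R) : 0 <= r <= t -> 0 <= s <= t -> U (x + r *: w + s *: v).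
    by move=> rt st; rewrite addrAC; exact: Uvw.
  have [r [s [rt st E1]]] := Svw _ t0 Uvw.
  have [r' [s' [rt' st' E2]]] := Swv _ t0 Uwv.
  have E : b (x + r *: v + s *: w) = a (x + s' *: v + r' *: w).
    apply: (mulfI (lt0r_neq0 t0)); apply: (mulfI (lt0r_neq0 t0)).
    rewrite -E1 (addrAC x (s' *: v)) -E2 (addrAC x (t *: w)).
    by ring.
  have [_ _ B1] := At r s rt st; have [_ B2 _] := At s' r' st' rt'.
  rewrite -(subrKA (a (x + s' *: v + r' *: w))).
  by rewrite (le_trans (ler_normD _ _))// lerD ?ltW// -E distrC.
apply/eqP; rewrite -subr_eq0 -normr_le0; apply/ler_addgt0Pr => e e0.
by rewrite add0r (splitr e) close// divr_gt0.
Unshelve. all: by end_near. Qed.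

(** Both iterated derivatives are limits of the same second difference
f(x+tv+tw) - f(x+tv) - f(x+tw) + f(x), divided by t². *)
Lemma derive_comm (U : set V) (f : V -> R) (x v w : V) : open U -> U x ->
  Ck 2 U f -> 'D_v ('D_w f) x = 'D_w ('D_v f) x.
Proof.
move=> oU Ux [df Df].
apply: (@second_difference_limit U f ('D_v ('D_w f)) ('D_w ('D_v f)) x v w).
- exact: oU.
- exact: Ux.
- by have [_ /(_ v)] := Df w; apply.
- by have [_ /(_ w)] := Df v; apply.
- by move=> t t0; apply: second_difference => //; have [] := Df v.
- by move=> t t0; apply: second_difference => //; have [] := Df w.
Qed.

End Schwarz.

(** * Bump functions on R^n *)

Section Bump.
Context {R : realType}.

(** The derivative of P(1/t) exp(-1/t) has the same form, with another
polynomial. Hence proving the first derivative of all these functions at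
once is enough to have the derivatives of any order. *)
Definition flat (P : {poly R}) (t : R) : R :=
  if 0 < t then P.[t^-1] * expR (- t^-1) else 0.

Definition dflat (P : {poly R}) : {poly R} := (P - P^`()) * 'X^2.

(** From exp(y/n) >= y/n, raised to the power n = k+2. *)
Lemma expRN_le (k : nat) (y : R) : 0 < y ->
  y ^+ k * expR (- y) <= k.+2%:R ^+ k.+2 * y^-1 ^+ 2.
Proof.
move=> y0; have n0 : 0 < k.+2%:R :> R by rewrite ltr0n.
have : (y / k.+2%:R) ^+ k.+2 <= expR y.
  rewrite -[in leRHS](divfK (lt0r_neq0 n0) y).
  rewrite expRM_natr lerXn2r ?nnegrE ?expR_ge0 ?divr_ge0 ?(ltW y0)//.
  by rewrite (le_trans _ (expR_ge1Dx _))// lerDr.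
rewrite expr_div_n ler_pdivrMr ?exprn_gt0// => h.
rewrite expRN ler_pdivrMr ?expR_gt0// exprVn mulrAC ler_pdivlMr ?exprn_gt0//.
by rewrite -exprD addn2 mulrC.
Qed.

(** The exponent 2 is what makes the difference quotient at 0 tend to 0. *)
Lemma flat_le (P : {poly R}) : exists2 C : R, 0 <= C &
  forall t, `|flat P t| <= C * t ^+ 2.
Proof.
exists (\sum_(k < size P) `|P`_k| * k.+2%:R ^+ k.+2).
  by apply: sumr_ge0 => k _; rewrite mulr_ge0// exprn_ge0.
move=> t; rewrite /flat; case: ifPn => [t0|_]; last first.
  rewrite normr0 mulr_ge0 ?sqr_ge0//.
  by apply: sumr_ge0 => k _; rewrite mulr_ge0// exprn_ge0.
rewrite horner_coef mulr_suml (le_trans (ler_norm_sum _ _ _))// mulr_suml.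
apply: ler_sum => k _; rewrite -mulrA normrM -mulrA ler_wpM2l//.
have tV0 : 0 < t^-1 by rewrite invr_gt0.
rewrite ger0_norm; last by rewrite mulr_ge0 ?expR_ge0// exprn_ge0// ltW.
by have := expRN_le k tV0; rewrite invrK.
Qed.

Lemma is_derive_flat0 (P : {poly R}) : is_derive (0 : R) 1 (flat P) 0.
Proof.
have [C C0 hC] := flat_le P.
have f0 : flat P 0 = 0 by rewrite /flat ltxx.
have cv : h^-1 *: ((flat P \o shift 0) (h *: (1 : R)) - flat P 0)
    @[h --> 0^'] --> (0 : R).
  apply/cvgrPdist_le => e e0; near=> h.
  rewrite sub0r normrN /= f0 subr0 addr0 /GRing.scale/= mulr1 normrM normfV.
  have h0 : h != 0 by near: h; exact: nbhs_dnbhs_neq.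
  rewrite ler_pdivrMl ?normr_gt0// (le_trans (hC h))//.
  rewrite -real_normK ?num_real// expr2 mulrA mulrC ler_wpM2l//.
  have : `|h| <= e / (C + 1).
    near: h; apply: dnbhs0_le; rewrite divr_gt0//.
    by rewrite ltr_wpDl.
  rewrite ler_pdivlMr ?ltr_wpDl// => /(le_trans _); apply.
  by rewrite mulrC ler_wpM2l// lerDl.
by apply: DeriveDef; [apply: cvgP cv|apply: cvg_lim cv].
Unshelve. all: by end_near. Qed.

Lemma is_derive_flat_gt0 (P : {poly R}) (t : R) : 0 < t ->
  is_derive t 1 (flat P) (flat (dflat P) t).
Proof.
move=> t0; have tn0 : t != 0 by exact: lt0r_neq0.
pose f := (horner P \o GRing.inv) * (expR \o (-%R \o GRing.inv)) : R -> R.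
have dV : is_derive t (1 : R) (GRing.inv : R -> R) (- t ^- 2).
  apply: DeriveDef; first exact: derivableV.
  by rewrite deriveV// derive_id /GRing.scale/= mulr1.
have dp : is_derive t (1 : R) (horner P \o GRing.inv)
    (P^`().[t^-1] * (- t ^- 2)).
  exact: is_derive1_comp.
have de : is_derive t (1 : R) (expR \o (-%R \o GRing.inv) : R -> R)
    (expR (- t^-1) * t ^- 2).
  have dN : is_derive t (1 : R) (-%R \o GRing.inv : R -> R) (t ^- 2).
    rewrite -[t ^- 2]opprK; exact: is_deriveN.
  exact: is_derive1_comp.
have df : is_derive t 1 f (flat (dflat P) t).
  apply: is_derive_eq; rewrite /flat t0 /dflat !hornerE /GRing.scale/=.
  by rewrite -exprVn; ring.
apply: near_eq_is_derive df; near=> s; rewrite /f /flat ifT//.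
by near: s; exact: lt_nbhsr.
Unshelve. all: by end_near. Qed.

Lemma is_derive_flat (P : {poly R}) (t : R) :
  is_derive t 1 (flat P) (flat (dflat P) t).
Proof.
have [t0|t0|->] := ltgtP t 0; last 2 first.
- exact: is_derive_flat_gt0.
- rewrite {2}/flat ltxx; exact: is_derive_flat0.
rewrite {2}/flat ltNge (ltW t0)/=.
have d0 := is_derive_cst (0 : R) t (1 : R).
apply: near_eq_is_derive d0; near=> s; rewrite /flat ltNge ltW//.
by near: s; exact: lt_nbhsl.
Unshelve. all: by end_near. Qed.

Lemma differentiable_flat (P : {poly R}) (t : R) : differentiable (flat P) t.
Proof. by apply/derivable1_diffP; have [] := is_derive_flat P t. Qed.

Lemma Ck_flat k (V : normedModType R) (U : set V) (q : V -> R) P : open U ->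
  Ck k U q -> Ck k U (flat P \o q).
Proof.
move=> oU; elim: k P => [|k IH] P.
  move=> cq x Ux; apply: continuous_comp; first exact: cq.
  exact/differentiable_continuous/differentiable_flat.
move=> Cq; have Cq' := CkW Cq; case: Cq => dq Dq; split=> [x Ux|v].
  by apply: differentiable_comp; [exact: dq|exact: differentiable_flat].
have C : Ck k U ('D_v q * (flat (dflat P) \o q)).
  by apply: CkM => //; [exact: Dq|exact: IH].
apply: Ck_ext C => // x Ux; rewrite mulrfctE /=.
have dc : differentiable (flat P \o q) x.
  by apply: differentiable_comp; [exact: dq|exact: differentiable_flat].
rewrite [RHS](deriveE v dc) diff_comp; [|exact: dq|exact: differentiable_flat].
rewrite /= -(deriveE v (dq x Ux)).
rewrite -[X in _ = 'd _ _ X]mulr1 [RHS]linearZ/= -deriveE; last first.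
  exact: differentiable_flat.
by have [_ ->] := is_derive_flat P (q x).
Qed.

(** The function exp(-1/t) of t = e² - |x - x0|², for the Euclidean norm, whose
balls are contained in those of the sup norm. *)
Lemma bump_rV n (x0 : 'rV[R]_n) (e : R) : 0 < e ->
  exists phi : 'rV[R]_n -> R, [/\ smooth_on setT phi, phi x0 != 0 &
    forall x, phi x != 0 -> ball x0 e x].
Proof.
move=> e0.
pose q := cst (e ^+ 2) - \sum_a
  (fun x : 'rV[R]_n => x 0 a - x0 0 a) * (fun x => x 0 a - x0 0 a).
have Eq x : q x = e ^+ 2 - \sum_a (x 0 a - x0 0 a) ^+ 2.
  rewrite /q; congr (_ - _); rewrite fct_sumE; apply: eq_bigr => a _.
  by rewrite mulrfctE expr2.
exists (flat 1 \o q); split.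
- move=> k; apply: Ck_flat; first exact: openT.
  have Cx a : Ck k setT (fun x : 'rV[R]_n => x 0 a - x0 0 a).
    apply: (@CkD _ _ _ _ _ (fun x : 'rV[R]_n => x 0 a) (cst (- x0 0 a))).
    + exact: openT.
    + apply: (@Ck_coord _ _ _ _ _ _ id); first exact: openT.
      exact: Ck_id.
    + exact: Ck_cst.
  apply: CkB; [exact: openT|exact: Ck_cst|].
  apply: Ck_sum; first exact: openT.
  by move=> a _; apply: CkM => //; exact: openT.
- rewrite /= Eq big1 ?subr0 /flat; last by move=> a _; rewrite subrr expr0n.
  by rewrite exprn_gt0// hornerE mul1r lt0r_neq0// expR_gt0.
- move=> x; rewrite /= /flat; case: ifPn => [|_]; last by rewrite eqxx.
  rewrite Eq subr_gt0 => h _.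
  split=> // i a; rewrite ord1 /ball/= distrC.
  rewrite -(@ltr_pXn2r _ 2) ?nnegrE ?normr_ge0 ?(ltW e0)//.
  rewrite real_normK ?num_real//.
  apply: le_lt_trans h; rewrite (bigD1 a)//= lerDl.
  by apply: sumr_ge0 => b _; exact: sqr_ge0.
Qed.

End Bump.

(** * Partial derivatives in a chart *)

Section ChartCalculus.
Context {R : realType} {n : nat} {M : manifold R n} (i : chart M).
Implicit Types (D : set M) (f g : M -> R) (p : M).

Definition chart_open D := open D /\ D `<=` cdom i.

(** D is in general smaller than the domain of the chart, as for functions that
are expressed in a second chart or composed with a map. *)
Definition smooth_in D f :=
  smooth_on (cmap i @` D) (f \o cinv i : 'rV[R]_n -> R).

Lemma chart_open_cdom : chart_open (cdom i).
Proof. by split => //; exact: cdom_open. Qed.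

Lemma cinv_imageK D x : chart_open D -> (cmap i @` D) x ->
  D (cinv i x) /\ cmap i (cinv i x) = x.
Proof. by move=> [_ Di] [q Dq <-]; rewrite cmapK//; exact: Di. Qed.

Lemma chart_image_open D : chart_open D -> open (cmap i @` D).
Proof.
move=> cD; have [oD Di] := cD.
rewrite openE => x Dx; have [Dx' xK] := cinv_imageK cD Dx.
have ix : (cmap i @` cdom i) x by case: Dx => q /Di iq <-; exists q.
have n1 : nbhs x (cmap i @` cdom i).
  by apply: open_nbhs_nbhs; split => //; exact: cmap_open.
have n2 : nbhs x (cinv i @^-1` D).
  by apply: cinv_continuous => //; exact: open_nbhs_nbhs.
apply: filterS (filterI n1 n2) => y [iy Dy].
by exists (cinv i y) => //; have [] := cinv_imageK chart_open_cdom iy.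
Qed.

Lemma image_nbhs D p : chart_open D -> D p -> nbhs (cmap i p) (cmap i @` D).
Proof.
move=> cD Dp; apply: open_nbhs_nbhs; split; first exact: chart_image_open.
by exists p.
Qed.

Section InDomain.
Context (D : set M) (cD : chart_open D).

Lemma smooth_in_ext f g : (forall p, D p -> f p = g p) ->
  smooth_in D f -> smooth_in D g.
Proof.
move=> fg sf k; apply: Ck_ext (sf k); first exact: chart_image_open.
by move=> x /(cinv_imageK cD)[Dx _]; exact: fg.
Qed.

Lemma smooth_in_cst c : smooth_in D (fun=> c).
Proof. by move=> k; exact: Ck_cst. Qed.

Lemma smooth_inD f g : smooth_in D f -> smooth_in D g ->
  smooth_in D (fun p => f p + g p).
Proof. by move=> sf sg k; apply: CkD => //; exact: chart_image_open. Qed.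

Lemma smooth_inN f : smooth_in D f -> smooth_in D (fun p => - f p).
Proof. by move=> sf k; apply: CkN => //; exact: chart_image_open. Qed.

Lemma smooth_inB f g : smooth_in D f -> smooth_in D g ->
  smooth_in D (fun p => f p - g p).
Proof. by move=> sf sg; apply: smooth_inD => //; exact: smooth_inN. Qed.

Lemma smooth_inM f g : smooth_in D f -> smooth_in D g ->
  smooth_in D (fun p => f p * g p).
Proof. by move=> sf sg k; apply: CkM => //; exact: chart_image_open. Qed.

Lemma smooth_in_sum (I : Type) (r : seq I) (P : pred I) (f : I -> M -> R) :
  (forall k, P k -> smooth_in D (f k)) ->
  smooth_in D (fun p => \sum_(k <- r | P k) f k p).
Proof.
move=> sf; elim: r => [|k r IH].
  by apply: smooth_in_ext (smooth_in_cst 0) => p _; rewrite big_nil.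
have [Pk|nPk] := boolP (P k).
  apply: smooth_in_ext (smooth_inD (sf k Pk) IH) => p _.
  by rewrite big_cons Pk.
by apply: smooth_in_ext IH => p _; rewrite big_cons (negPf nPk).
Qed.

Lemma smooth_in_prod (I : Type) (r : seq I) (P : pred I) (f : I -> M -> R) :
  (forall k, P k -> smooth_in D (f k)) ->
  smooth_in D (fun p => \prod_(k <- r | P k) f k p).
Proof.
move=> sf; elim: r => [|k r IH].
  by apply: smooth_in_ext (smooth_in_cst 1) => p _; rewrite big_nil.
have [Pk|nPk] := boolP (P k).
  apply: smooth_in_ext (smooth_inM (sf k Pk) IH) => p _.
  by rewrite big_cons Pk.
by apply: smooth_in_ext IH => p _; rewrite big_cons (negPf nPk).
Qed.

Lemma smooth_inV f : (forall p, D p -> f p != 0) -> smooth_in D f ->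
  smooth_in D (fun p => (f p)^-1).
Proof.
move=> f0 sf k; apply: (@CkV _ _ _ _ (f \o cinv i)) => //.
  exact: chart_image_open.
by move=> x /(cinv_imageK cD)[Dx _]; exact: f0.
Qed.

Lemma smooth_in_pd a f : smooth_in D f -> smooth_in D (pd i a f).
Proof.
move=> sf k; have [_ Df] := sf k.+1.
apply: Ck_ext (Df (delta_mx 0 a)); first exact: chart_image_open.
by move=> x /(cinv_imageK cD)[_ xK]; rewrite /pd /= xK.
Qed.

Lemma smooth_in_differentiable f p : smooth_in D f -> D p ->
  differentiable (f \o cinv i : 'rV[R]_n -> R) (cmap i p).
Proof. by move=> sf Dp; have [df _] := sf 1%N; apply: df; exists p. Qed.

Lemma smooth_in_derivable f p v : smooth_in D f -> D p ->
  derivable (f \o cinv i : 'rV[R]_n -> R) (cmap i p) v.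
Proof. by move=> sf Dp; exact/diff_derivable/smooth_in_differentiable. Qed.

Lemma pd_ext a f g p : (forall q, D q -> f q = g q) -> D p ->
  pd i a f p = pd i a g p.
Proof.
move=> fg Dp; apply: near_eq_derive.
by apply: filterS (image_nbhs cD Dp) => x /(cinv_imageK cD)[Dx _]; exact: fg.
Qed.

Lemma pd_cst a c p : pd i a (fun=> c) p = 0.
Proof. exact: derive_cst. Qed.

Lemma pdD a f g p : smooth_in D f -> smooth_in D g -> D p ->
  pd i a (fun q => f q + g q) p = pd i a f p + pd i a g p.
Proof. by move=> sf sg Dp; apply: deriveD; exact: smooth_in_derivable. Qed.

Lemma pdN a f p : smooth_in D f -> D p ->
  pd i a (fun q => - f q) p = - pd i a f p.
Proof. by move=> sf Dp; apply: deriveN; exact: smooth_in_derivable. Qed.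

Lemma pdM a f g p : smooth_in D f -> smooth_in D g -> D p ->
  pd i a (fun q => f q * g q) p = pd i a f p * g p + f p * pd i a g p.
Proof.
move=> sf sg Dp; rewrite addrC.
have ip : cdom i p by have [_] := cD; exact.
have df := smooth_in_derivable (v := delta_mx 0 a) sf Dp.
have dg := smooth_in_derivable (v := delta_mx 0 a) sg Dp.
rewrite /pd [LHS](deriveM df dg) /= cmapK// /GRing.scale/=.
by congr (_ + _); rewrite mulrC.
Qed.

Lemma pd_sum a (I : Type) (r : seq I) (P : pred I) (f : I -> M -> R) p :
  (forall k, P k -> smooth_in D (f k)) -> D p ->
  pd i a (fun q => \sum_(k <- r | P k) f k q) p =
  \sum_(k <- r | P k) pd i a (f k) p.
Proof.
move=> sf Dp; elim: r => [|k r IH].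
  rewrite big_nil -[RHS](pd_cst a 0 p).
  by apply: pd_ext Dp => q _; rewrite big_nil.
rewrite big_cons; have [Pk|nPk] := boolP (P k).
  rewrite -IH -pdD//; [|exact: sf|exact: smooth_in_sum].
  by apply: pd_ext Dp => q _; rewrite big_cons Pk.
by rewrite -IH; apply: pd_ext Dp => q _; rewrite big_cons (negPf nPk).
Qed.

(** The maps of the chart being mutually inverse only on its domain, [pd] can be
iterated only up to equality near the point. *)
Lemma pd_comm a b f p : smooth_in D f -> D p ->
  pd i a (pd i b f) p = pd i b (pd i a f) p.
Proof.
move=> sf Dp.
have E u v : pd i u (pd i v f) p =
    'D_(delta_mx 0 u)
      ('D_(delta_mx 0 v) (f \o cinv i : 'rV[R]_n -> R)) (cmap i p).
  apply: near_eq_derive; apply: filterS (image_nbhs cD Dp) => x.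
  by move=> /(cinv_imageK cD)[_ xK]; rewrite /pd /= xK.
rewrite !E; apply: derive_comm (sf 2); first exact: chart_image_open.
by exists p.
Qed.

(** The matrix of componentwise derivatives, for which the usual rules for
products of noncommuting factors hold. *)
Definition dmx k l (a : 'I_n) (A : M -> 'M[R]_(k, l)) p : 'M[R]_(k, l) :=
  \matrix_(u, v) pd i a (fun q => A q u v) p.

Definition smooth_mx k l (A : M -> 'M[R]_(k, l)) :=
  forall u v, smooth_in D (fun q => A q u v).

Lemma smooth_mx_ext k l (A B : M -> 'M[R]_(k, l)) :
  (forall p, D p -> A p = B p) -> smooth_mx A -> smooth_mx B.
Proof.
by move=> AB sA u v; apply: smooth_in_ext (sA u v) => p Dp; rewrite AB.
Qed.

Lemma smooth_mxD k l (A B : M -> 'M[R]_(k, l)) : smooth_mx A -> smooth_mx B ->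
  smooth_mx (fun q => A q + B q).
Proof.
move=> sA sB u v; apply: smooth_in_ext (smooth_inD (sA u v) (sB u v)) => p _.
by rewrite mxE.
Qed.

Lemma smooth_mxN k l (A : M -> 'M[R]_(k, l)) : smooth_mx A ->
  smooth_mx (fun q => - A q).
Proof.
move=> sA u v; apply: smooth_in_ext (smooth_inN (sA u v)) => p _.
by rewrite mxE.
Qed.

Lemma smooth_mxM k l r (A : M -> 'M[R]_(k, l)) (B : M -> 'M[R]_(l, r)) :
  smooth_mx A -> smooth_mx B -> smooth_mx (fun q => A q *m B q).
Proof.
move=> sA sB u v.
have s : smooth_in D (fun q => \sum_w A q u w * B q w v).
  by apply: smooth_in_sum => w _; exact: smooth_inM.
by apply: smooth_in_ext s => p _; rewrite mxE.
Qed.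

Lemma smooth_mxZ k l f (A : M -> 'M[R]_(k, l)) : smooth_in D f ->
  smooth_mx A -> smooth_mx (fun q => f q *: A q).
Proof.
move=> sf sA u v; apply: smooth_in_ext (smooth_inM sf (sA u v)) => p _.
by rewrite mxE.
Qed.

Lemma smooth_mx_sum k l (I : finType) (A : I -> M -> 'M[R]_(k, l)) :
  (forall w, smooth_mx (A w)) -> smooth_mx (fun q => \sum_w A w q).
Proof.
move=> sA u v.
have s : smooth_in D (fun q => \sum_w A w q u v).
  by apply: smooth_in_sum => w _; exact: sA.
by apply: smooth_in_ext s => p _; rewrite summxE.
Qed.

Lemma smooth_mx_tr k l (A : M -> 'M[R]_(k, l)) : smooth_mx A ->
  smooth_mx (fun q => (A q)^T).
Proof.
by move=> sA u v; apply: smooth_in_ext (sA v u) => p _; rewrite mxE.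
Qed.

Lemma smooth_mx_det k (A : M -> 'M[R]_k) : smooth_mx A ->
  smooth_in D (fun q => \det (A q)).
Proof.
move=> sA; apply: smooth_in_sum => s _; apply: smooth_inM.
  exact: smooth_in_cst.
by apply: smooth_in_prod => u _; exact: sA.
Qed.

(** By Cramer's rule. *)
Lemma smooth_mx_inv k (A : M -> 'M[R]_k) : smooth_mx A ->
  (forall p, D p -> A p \in unitmx) -> smooth_mx (fun q => invmx (A q)).
Proof.
move=> sA uA u v.
have sV : smooth_in D (fun q => (\det (A q))^-1).
  apply: smooth_inV; last exact: smooth_mx_det.
  by move=> p /uA; rewrite unitmxE unitfE.
have sadj : smooth_in D (fun q => \adj (A q) u v).
  have s : smooth_in D (fun q =>
      (-1) ^+ (v + u) * \det (row' v (col' u (A q)))).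
    apply: smooth_inM; first exact: smooth_in_cst.
    apply: smooth_mx_det => u' v'.
    by apply: smooth_in_ext (sA (lift v u') (lift u v')) => p _; rewrite !mxE.
  by apply: smooth_in_ext s => p _; rewrite mxE.
apply: smooth_in_ext (smooth_inM sV sadj) => p Dp.
by rewrite /invmx (uA p Dp) [RHS]mxE.
Qed.

Lemma smooth_dmx k l a (A : M -> 'M[R]_(k, l)) : smooth_mx A ->
  smooth_mx (dmx a A).
Proof.
move=> sA u v; apply: smooth_in_ext (smooth_in_pd a (sA u v)) => p _.
by rewrite mxE.
Qed.

Lemma dmx_ext k l a (A B : M -> 'M[R]_(k, l)) p :
  (forall q, D q -> A q = B q) -> D p -> dmx a A p = dmx a B p.
Proof.
move=> AB Dp; apply/matrixP => u v; rewrite !mxE.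
by apply: pd_ext Dp => q Dq; rewrite AB.
Qed.

Lemma dmxD k l a (A B : M -> 'M[R]_(k, l)) p : smooth_mx A -> smooth_mx B ->
  D p -> dmx a (fun q => A q + B q) p = dmx a A p + dmx a B p.
Proof.
move=> sA sB Dp; apply/matrixP => u v; rewrite !mxE -pdD//.
by apply: pd_ext Dp => q _; rewrite mxE.
Qed.

Lemma dmxN k l a (A : M -> 'M[R]_(k, l)) p : smooth_mx A ->
  D p -> dmx a (fun q => - A q) p = - dmx a A p.
Proof.
move=> sA Dp; apply/matrixP => u v; rewrite !mxE -pdN//.
by apply: pd_ext Dp => q _; rewrite mxE.
Qed.

Lemma dmxB k l a (A B : M -> 'M[R]_(k, l)) p : smooth_mx A -> smooth_mx B ->
  D p -> dmx a (fun q => A q - B q) p = dmx a A p - dmx a B p.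
Proof. by move=> sA sB Dp; rewrite dmxD ?dmxN//; exact: smooth_mxN. Qed.

Lemma dmxM k l r a (A : M -> 'M[R]_(k, l)) (B : M -> 'M[R]_(l, r)) p :
  smooth_mx A -> smooth_mx B -> D p ->
  dmx a (fun q => A q *m B q) p = dmx a A p *m B p + A p *m dmx a B p.
Proof.
move=> sA sB Dp; apply/matrixP => u v; rewrite !mxE -big_split/=.
rewrite -[LHS]/(pd i a (fun q => (A q *m B q) u v) p).
transitivity (pd i a (fun q => \sum_w A q u w * B q w v) p).
  by apply: pd_ext Dp => q _; rewrite mxE.
rewrite pd_sum//; last by move=> w _; exact: smooth_inM.
by apply: eq_bigr => w _; rewrite pdM// !mxE.
Qed.

Lemma dmxZ k l a f (A : M -> 'M[R]_(k, l)) p : smooth_in D f ->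
  smooth_mx A -> D p ->
  dmx a (fun q => f q *: A q) p = pd i a f p *: A p + f p *: dmx a A p.
Proof.
move=> sf sA Dp; apply/matrixP => u v; rewrite !mxE -pdM//.
by apply: pd_ext Dp => q _; rewrite mxE.
Qed.

Lemma dmx_tr k l a (A : M -> 'M[R]_(k, l)) p : D p ->
  dmx a (fun q => (A q)^T) p = (dmx a A p)^T.
Proof.
move=> Dp; apply/matrixP => u v; rewrite !mxE.
by apply: pd_ext Dp => q _; rewrite mxE.
Qed.

Lemma dmx_sum k l a (I : finType) (A : I -> M -> 'M[R]_(k, l)) p :
  (forall w, smooth_mx (A w)) -> D p ->
  dmx a (fun q => \sum_w A w q) p = \sum_w dmx a (A w) p.
Proof.
move=> sA Dp; apply/matrixP => u v; rewrite summxE !mxE.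
transitivity (pd i a (fun q => \sum_w A w q u v) p).
  by apply: pd_ext Dp => q _; rewrite summxE.
rewrite pd_sum//; last by move=> w _; exact: sA.
by apply: eq_bigr => w _; rewrite mxE.
Qed.

Lemma dmx_cst k l a (A : 'M[R]_(k, l)) p : dmx a (fun=> A) p = 0.
Proof. by apply/matrixP => u v; rewrite !mxE pd_cst. Qed.

Lemma dmx_comm k l a b (A : M -> 'M[R]_(k, l)) p : smooth_mx A -> D p ->
  dmx a (dmx b A) p = dmx b (dmx a A) p.
Proof.
move=> sA Dp; apply/matrixP => u v; rewrite [LHS]mxE [RHS]mxE.
have E c d : pd i c (fun q => dmx d A q u v) p =
    pd i c (pd i d (fun q => A q u v)) p.
  by apply: pd_ext Dp => q _; rewrite mxE.
by rewrite E [RHS]E; exact: pd_comm.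
Qed.

End InDomain.
End ChartCalculus.

(** * Change of coordinates and cut-off vector fields *)

Lemma smooth_inS (R : realType) n (M : manifold R n) (i : chart M)
    (D D' : set M) (f : M -> R) :
  D' `<=` D -> smooth_in i D f -> smooth_in i D' f.
Proof.
move=> DD sf k; apply: CkS (sf k) => x [q D'q <-]; exists q => //; exact: DD.
Qed.

Lemma smooth_mxP (R : realType) n (M : manifold R n) (i : chart M) (D : set M)
    k l (A : M -> 'M[R]_(k, l)) : chart_open i D ->
  smooth_on (cmap i @` D) (A \o cinv i : 'rV[R]_n -> _) <-> smooth_mx i D A.
Proof.
move=> cD; have oD := chart_image_open cD; split=> sA.
  by move=> u v r; apply: (@Ck_coord _ r _ _ _ _ (A \o cinv i) u v).
by move=> r; apply: Ck_mx => // u v; exact: sA.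
Qed.

Section ChainRule.
Context {R : realType} {m n : nat} {M : manifold R m} {N : manifold R n}.
Context (F : M -> N) (i : chart M) (j : chart N) (D : set M) (D' : set N).
Hypotheses (cD : chart_open i D) (cD' : chart_open j D').
Hypothesis FD : forall p, D p -> D' (F p).
Hypothesis sF : smooth_mx i D (fun q => cmap j (F q)).

Let FinvK p : D p -> cinv j (cmap j (F p)) = F p.
Proof. by move=> /FD Fp; apply: cmapK; have [_] := cD'; exact. Qed.

Let coord_image x : (cmap i @` D) x -> (cmap j @` D') (cmap j (F (cinv i x))).
Proof.
by move=> /(cinv_imageK cD)[Dx _]; exists (F (cinv i x)) => //; exact: FD.
Qed.

Lemma smooth_in_comp u : smooth_in j D' u -> smooth_in i D (u \o F).
Proof.
move=> su k; have oD := chart_image_open cD.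
have Cf : Ck k (cmap i @` D) (fun x => cmap j (F (cinv i x)) : 'rV[R]_n).
  exact: ((smooth_mxP _ cD).2 sF k).
apply: Ck_ext (Ck_comp oD coord_image (su k) Cf) => //.
by move=> x /(cinv_imageK cD)[Dx _] /=; rewrite FinvK.
Qed.

Lemma pd_comp a u p : smooth_in j D' u -> D p ->
  pd i a (u \o F) p = \sum_b jac F i j p a b * pd j b u (F p).
Proof.
move=> su Dp; have ip : cdom i p by have [_] := cD; exact.
pose f x : 'rV[R]_n := cmap j (F (cinv i x)).
have df : differentiable f (cmap i p).
  by have [df _] := (smooth_mxP _ cD).2 sF 1%N; apply: df; exists p.
have Ef : f (cmap i p) = cmap j (F p) by rewrite /f cmapK.
have du : differentiable (u \o cinv j : 'rV[R]_n -> R) (f (cmap i p)).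
  by rewrite Ef; apply: smooth_in_differentiable su _; exact: FD.
transitivity ('D_(delta_mx 0 a) ((u \o cinv j) \o f) (cmap i p)).
  apply: near_eq_derive; apply: filterS (image_nbhs cD Dp) => x.
  by move=> /(cinv_imageK cD)[Dx _]; rewrite /f /= FinvK.
rewrite derive_comp_row//; apply: eq_bigr => b _.
by rewrite Ef mxE.
Qed.

Lemma smooth_mx_comp k l (A : N -> 'M[R]_(k, l)) : smooth_mx j D' A ->
  smooth_mx i D (A \o F).
Proof. by move=> sA u v; exact: smooth_in_comp (sA u v). Qed.

Lemma dmx_comp k l a (A : N -> 'M[R]_(k, l)) p : smooth_mx j D' A -> D p ->
  dmx i a (A \o F) p = \sum_b jac F i j p a b *: dmx j b A (F p).
Proof.
move=> sA Dp; apply/matrixP => u v; rewrite mxE summxE.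
rewrite (pd_comp a (sA u v) Dp).
by apply: eq_bigr => b _; rewrite !mxE.
Qed.

Lemma smooth_jac : smooth_mx i D (jac F i j).
Proof.
move=> a b; apply: (smooth_in_ext cD) (smooth_in_pd cD a (sF 0 b)) => p _.
by rewrite mxE.
Qed.

Lemma pd_jac_sym a b c p : D p ->
  pd i a (fun q => jac F i j q b c) p = pd i b (fun q => jac F i j q a c) p.
Proof.
move=> Dp.
have E u v : pd i u (fun q => jac F i j q v c) p =
    pd i u (pd i v (fun q => cmap j (F q) 0 c)) p.
  by apply: (pd_ext cD) Dp => q _; rewrite mxE.
by rewrite E [RHS]E; apply: (pd_comm cD) Dp; exact: sF.
Qed.

End ChainRule.

Section ChangeOfChart.
Context {R : realType} {n : nat} {M : manifold R n}.
Implicit Types (i j k : chart M) (D : set M).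

Lemma smooth_transition i j D : chart_open i D -> chart_open j D ->
  smooth_mx i D (fun q => cmap j q).
Proof.
move=> cD [_ Dj] u v r.
have Cij := transition_smooth i j r.
apply: (@Ck_coord _ _ _ _ _ _ (cmap j \o cinv i) u v).
  exact: chart_image_open.
apply: CkS Cij => _ [q Dq <-]; exists q => //.
by split; [have [_] := cD; exact|exact: Dj].
Qed.

Lemma smooth_in_change i j D f : chart_open i D -> chart_open j D ->
  smooth_in j D f -> smooth_in i D f.
Proof.
move=> ci cj sf; apply: (@smooth_in_comp _ _ _ _ _ id i j D D) => //.
exact: smooth_transition.
Qed.

Lemma chart_openI i D : open D -> chart_open i (cdom i `&` D).
Proof. by move=> oD; split; [exact: openI (cdom_open _) oD|move=> p []]. Qed.

(** The chain rule for the identity map read in three charts. *)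
Lemma jac_cocycle i j k p : cdom i p -> cdom j p -> cdom k p ->
  jac (@id M) i k p = jac (@id M) i j p *m jac (@id M) j k p.
Proof.
move=> ip jp kp; pose D := cdom i `&` (cdom j `&` cdom k).
have oD : open D by do 2?apply: openI; exact: cdom_open.
have ci : chart_open i D by split=> // q [].
have cj : chart_open j D by split=> // q [_ []].
have ck : chart_open k D by split=> // q [_ []].
have Dp : D p by [].
apply/matrixP => a c; rewrite mxE [RHS]mxE.
rewrite -[LHS]/(pd i a ((fun q => cmap k q 0 c) \o id) p).
rewrite (@pd_comp _ _ _ _ _ id i j D D)//; last 2 first.
- exact: smooth_transition.
- exact: (smooth_transition cj ck).
by apply: eq_bigr => b _; congr (_ * _); rewrite [RHS]mxE.
Qed.

Lemma jac_id i p : cdom i p -> jac (@id M) i i p = 1%:M.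
Proof.
move=> ip; apply/matrixP => a b; rewrite !mxE.
rewrite /pd (@near_eq_derive _ _ _ _ (fun x : 'rV[R]_n => x 0 b)); last first.
  apply: filterS (image_nbhs (chart_open_cdom i) ip) => x.
  by move=> /(cinv_imageK (chart_open_cdom i))[_ /= ->].
have dx v : derivable (id : 'rV[R]_n -> 'rV[R]_n) (cmap i p) v.
  exact: derivable_id.
have := derive_mx (dx (delta_mx 0 a)); rewrite derive_id => /matrixP/(_ 0 b).
by rewrite !mxE eqxx => <-; rewrite eq_sym.
Qed.

(** A field which is constant in a chart, cut off by a bump function supported
in this chart. The Hausdorff hypothesis makes its compact support closed in M,
whence the smoothness of the extension by 0. *)
Lemma vfield_through i0 p a : cdom i0 p ->
  exists (X : vfield M) (c : R), c != 0 /\ X i0 p = c *: delta_mx 0 a.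
Proof.
move=> ip.
have /nbhs_ballP[e /= e0 eD] := image_nbhs (chart_open_cdom i0) ip.
have e20 : 0 < e / 2 by rewrite divr_gt0.
have [phi [sphi phi0 phiB]] := bump_rV (cmap i0 p) e20.
pose K := closed_ball (cmap i0 p) (e / 2).
have KD : K `<=` cmap i0 @` cdom i0.
  move=> x Kx; apply: eD; apply: closed_ball_subset Kx => //.
  by rewrite gtr_pMr// invf_lt1// ltr1n.
have cK : compact K.
  apply: bounded_closed_compact; last exact: closed_ball_closed.
  rewrite /K closed_ballE//; exists (`|cmap i0 p| + e / 2); split.
    exact: num_real.
  move=> r hr x; rewrite /closed_ball_ /= => hx.
  rewrite (le_trans _ (ltW hr))// -(subrK (cmap i0 p) x) addrC.
  by rewrite (le_trans (ler_normD _ _))// lerD2l distrC.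
pose C := cinv i0 @` K.
have cC : closed C.
  apply: compact_closed; first exact: manifold_hausdorff.
  apply: continuous_compact => //; apply: continuous_in_subspaceT => x.
  by rewrite inE => /KD; exact: cinv_continuous.
have Cphi q : cdom i0 q -> ~ C q -> phi (cmap i0 q) = 0.
  move=> iq nCq; apply/eqP; apply: contraT => /phiB Bq; exfalso; apply: nCq.
  by exists (cmap i0 q); [exact: subset_closure|rewrite cmapK].
pose X i q : 'rV[R]_n := if pselect (cdom i0 q) then
  phi (cmap i0 q) *: (delta_mx 0 a *m jac (@id M) i0 i q) else 0.
have sX i : smooth_on (cmap i @` cdom i) (X i \o cinv i).
  move=> k; apply: Ck_local => _ [q iq <-].
  have [i0q|ni0q] := pselect (cdom i0 q).
    pose D := cdom i `&` cdom i0.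
    have cD : chart_open i D by apply: chart_openI; exact: cdom_open.
    have cD0 : chart_open i0 D by split; [have [] := cD|move=> r []].
    exists (cmap i @` D); first by exists q.
    apply: (smooth_mxP _ cD).2 => u v.
    apply: (smooth_in_change cD cD0).
    apply: (@smooth_mx_ext _ _ _ _ _ cD0 _ _ (fun q =>
        phi (cmap i0 q) *: (delta_mx 0 a *m jac (@id M) i0 i q)))
      => [r [ir i0r]|].
      by rewrite /X; case: pselect.
    apply: (smooth_mxZ cD0).
      move=> l; apply: Ck_ext (CkS (@subsetT _ _) (sphi l)).
        exact: chart_image_open.
      by move=> x /(cinv_imageK cD0)[_ /= ->].
    apply: (smooth_mxM cD0); first by move=> ? ?; exact: smooth_in_cst.
    apply: smooth_jac => //; exact: smooth_transition.
  have nCq : ~ C q.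
    by move=> [x /KD xi qE]; apply: ni0q; rewrite -qE; have [] :=
      cinv_imageK (chart_open_cdom i0) xi.
  have cD : chart_open i (cdom i `&` ~` C).
    by apply: chart_openI; exact: closed_openC.
  exists (cmap i @` (cdom i `&` ~` C)); first by exists q.
  apply: (smooth_mxP _ cD).2.
  apply: (@smooth_mx_ext _ _ _ _ _ cD _ _ (fun=> 0)) => [r [ir nCr]|u v].
    by rewrite /X; case: pselect => // i0r; rewrite Cphi// scale0r.
  exact: smooth_in_cst.
have Xchange i j q : cdom i q -> cdom j q -> X j q = X i q *m jac (@id M) i j q.
  move=> iq jq; rewrite /X.
  case: (pselect (cdom i0 q)) => [i0q|_] /=; last by rewrite mul0mx.
  by rewrite (jac_cocycle i0q iq jq) mulmxA scalemxAl.
exists (VField sX Xchange), (phi (cmap i0 p)); split=> //=.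
by rewrite /X; case: pselect => // i0p; rewrite jac_id// mulmx1.
Qed.

End ChangeOfChart.

(** * The Levi-Civita connection in coordinates *)

Section LeviCivita.
Context {R : realType} {n : nat} {M : manifold R n}.
Context (g : metric M) (i : chart M).
Implicit Types (X Y : M -> 'rV[R]_n) (p : M).

(** The matrix, acting on rows, of Y |-> ∇_(e_a) Y - ∂_a Y. *)
Definition connection (a : 'I_n) p : 'M[R]_n :=
  \matrix_(b, c) christoffel g i a b c p.

Definition curvature (a b : 'I_n) p : 'M[R]_n :=
  dmx i a (connection b) p - dmx i b (connection a) p
  + (connection b p *m connection a p - connection a p *m connection b p).

(** Row a is ∇_(e_a) X. *)
Definition covariant_diff X p : 'M[R]_n :=
  \matrix_(a, c) (dmx i a X p + X p *m connection a p) 0 c.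

Lemma smooth_gcomp : smooth_mx i (cdom i) (g i).
Proof. exact: (smooth_mxP _ (chart_open_cdom i)).1 (gcomp_smooth g i). Qed.

Lemma smooth_vcomp (X : vfield M) : smooth_mx i (cdom i) (X i).
Proof. exact: (smooth_mxP _ (chart_open_cdom i)).1 (vcomp_smooth X i). Qed.

Lemma smooth_connection a : smooth_mx i (cdom i) (connection a).
Proof.
have ci := chart_open_cdom i.
have sg := smooth_gcomp.
have sG : smooth_mx i (cdom i) (fun q => invmx (g i q)).
  by apply: (smooth_mx_inv ci sg) => p; exact: gcomp_unit.
move=> b c; apply: (@smooth_in_ext _ _ _ _ _ ci (christoffel g i a b c)).
  by move=> p _; rewrite mxE.
apply: (smooth_inM ci); first exact: smooth_in_cst.
apply: (smooth_in_sum ci) => d _; apply: (smooth_inM ci); first exact: sG.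
apply: (smooth_inB ci); last exact: smooth_in_pd.
by apply: (smooth_inD ci); exact: smooth_in_pd.
Qed.

Lemma nablaE X Y p : nabla g i X Y p =
  \sum_a X p 0 a *: (dmx i a Y p + Y p *m connection a p).
Proof.
apply/rowP => c; rewrite summxE mxE -big_split/=; apply: eq_bigr => a _.
rewrite !mxE mulrDr; congr (_ + _); rewrite mulr_sumr; apply: eq_bigr => b _.
by rewrite mxE [christoffel _ _ _ _ _ _ * _]mulrC -mulrA [_ * Y p 0 b]mulrC.
Qed.

Lemma sum_delta k l (a : 'I_k) (v : 'I_k -> 'M[R]_(1, l)) :
  \sum_b (delta_mx 0 a : 'rV[R]_k) 0 b *: v b = v a.
Proof.
rewrite (bigD1 a)//= mxE !eqxx scale1r big1 ?addr0// => b ba.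
by rewrite mxE (negPf ba) andbF scale0r.
Qed.

Lemma nabla_frame a Y p :
  nabla g i (frame a) Y p = dmx i a Y p + Y p *m connection a p.
Proof. by rewrite nablaE sum_delta. Qed.

Lemma bracket_frame X a p : bracket i X (frame a) p = - dmx i a X p.
Proof.
apply/rowP => c; rewrite !mxE /dirderiv big1 ?sub0r; last first.
  by move=> b _; rewrite (pd_cst i b (delta_mx 0 a 0 c)) mulr0.
rewrite [RHS]mxE [dmx _ _ _ _ _ _]mxE; congr (- _).
rewrite (bigD1 a)//= mxE !eqxx mul1r big1 ?addr0// => b ba.
by rewrite mxE (negPf ba) andbF mul0r.
Qed.

Lemma riem_frame a b c p : cdom i p ->
  riem g i (frame a) (frame b) (frame c) p = delta_mx 0 c *m curvature a b p.
Proof.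
move=> ip; have ci := chart_open_cdom i.
have nf u : nabla g i (frame u) (frame c) =
    fun q => delta_mx 0 c *m connection u q.
  by apply/funext => q; rewrite nabla_frame (dmx_cst i u (delta_mx 0 c)) add0r.
have br : bracket i (frame a) (frame b) p = 0.
  by rewrite bracket_frame (dmx_cst i b (delta_mx 0 a)) oppr0.
have dc u v : dmx i u (fun q => (delta_mx 0 c : 'rV_n) *m connection v q) p =
    delta_mx 0 c *m dmx i u (connection v) p.
  rewrite (dmxM ci)//; last exact: smooth_connection.
    by rewrite dmx_cst mul0mx add0r.
  by move=> ? ?; exact: smooth_in_cst.
rewrite /riem !nf !nabla_frame !dc [nabla _ _ (bracket _ _ _) _ _]nablaE br.
rewrite [X in _ - X]big1 ?subr0; last by move=> u _; rewrite mxE scale0r.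
by rewrite /curvature mulmxDr !mulmxBr !mulmxA opprD addrACA.
Qed.

Lemma ricciE b c p : cdom i p -> ricci g i p b c = \sum_a curvature a b p c a.
Proof.
move=> ip; rewrite mxE; apply: eq_bigr => a _.
by rewrite riem_frame// -rowE mxE.
Qed.

Lemma ginner_frame X a p : ginner g i X (frame a) p = (X p *m g i p) 0 a.
Proof. by rewrite /ginner /frame trmx_delta -colE mxE. Qed.

Lemma ginner_sym X Y p : cdom i p -> ginner g i X Y p = ginner g i Y X p.
Proof.
move=> ip; rewrite /ginner -[LHS]trace_mx11 -mxtrace_tr trace_mx11.
by rewrite !trmx_mul trmxK gcomp_sym// mulmxA.
Qed.

Lemma dmx_gcomp a p : cdom i p ->
  dmx i a (g i) p = connection a p *m g i p + (connection a p *m g i p)^T.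
Proof.
move=> ip; apply/matrixP => b c; rewrite [LHS]mxE nabla_metric//.
have E u v : ginner g i (nabla g i (frame a) (frame u)) (frame v) p =
    (connection a p *m g i p) u v.
  rewrite ginner_frame nabla_frame (dmx_cst i a (delta_mx 0 u)) add0r.
  by rewrite -mulmxA -rowE mxE.
rewrite [X in _ + X]ginner_sym// !E [RHS]mxE.
by congr (_ + _); rewrite [RHS]mxE.
Qed.

Lemma connection_sym a b c p : cdom i p ->
  connection a p b c = connection b p a c.
Proof. by move=> ip; rewrite !mxE christoffel_sym. Qed.

(** Metric compatibility makes R(X, Y) skew-adjoint: this is the symmetry of the
second derivatives of the components of g. *)
Lemma curvature_skew a b p : cdom i p ->
  curvature a b p *m g i p = - (curvature a b p *m g i p)^T.
Proof.
move=> ip; have ci := chart_open_cdom i; have sg := smooth_gcomp.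
have sc := smooth_connection.
have E u v : dmx i u (dmx i v (g i)) p =
    (dmx i u (connection v) p *m g i p
     + connection v p
       *m (connection u p *m g i p + (connection u p *m g i p)^T))
    + (dmx i u (connection v) p *m g i p
     + connection v p
       *m (connection u p *m g i p + (connection u p *m g i p)^T))^T.
  transitivity (dmx i u (fun q =>
     connection v q *m g i q + (connection v q *m g i q)^T) p).
    by apply: (dmx_ext ci) ip => q iq; exact: dmx_gcomp.
  have s : smooth_mx i (cdom i) (fun q => connection v q *m g i q).
    exact: smooth_mxM.
  rewrite (dmxD ci)//; last exact: smooth_mx_tr.
  by rewrite (dmx_tr ci)// (dmxM ci)// dmx_gcomp.
have := dmx_comm ci a b sg ip; rewrite !E /curvature.
move: (dmx i a (connection b) p) (dmx i b (connection a) p).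
move: (connection a p) (connection b p) (g i p) (gcomp_sym g ip).
move=> A B G GT dB dA /eqP; rewrite -subr_eq0 => /eqP H.
apply/eqP; rewrite -subr_eq0 opprK; apply/eqP; rewrite -[RHS]H.
have -> : (dB - dA + (B *m A - A *m B)) *m G =
    dB *m G - dA *m G + (B *m (A *m G) - A *m (B *m G)).
  by rewrite !(mulmxDl, mulNmx) !mulmxA.
have K : (B *m (A *m G)^T)^T = A *m (B *m G)^T.
  by rewrite !trmx_mul !trmxK GT mulmxA.
rewrite !mulmxDr -K.
move: (dB *m G) (dA *m G) (B *m (A *m G)) (A *m (B *m G)) (B *m (A *m G)^T).
move=> P Q S T Y; apply/matrixP => u v; rewrite !mxE; ring.
Qed.

(** This is (L_X g)(Y, W) = g(∇_Y X, W) + g(Y, ∇_W X). *)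
Lemma lie_metricE X p : cdom i p ->
  lie_metric g i X p =
    covariant_diff X p *m g i p + (covariant_diff X p *m g i p)^T.
Proof.
move=> ip; apply/matrixP => a b.
have covE u v : (covariant_diff X p *m g i p) u v =
    (dmx i u X p *m g i p) 0 v + (X p *m connection u p *m g i p) 0 v.
  rewrite mxE [X in X + _]mxE [X in _ + X]mxE -big_split/=.
  by apply: eq_bigr => c _; rewrite !mxE mulrDl.
have XG u v : (X p *m connection u p *m g i p) 0 v =
    \sum_c X p 0 c * (connection c p *m g i p) u v.
  rewrite -mulmxA mxE; apply: eq_bigr => c _; congr (_ * _).
  by rewrite !mxE; apply: eq_bigr => d _; rewrite connection_sym.
rewrite /lie_metric [LHS]mxE [RHS]mxE [_^T _ _]mxE !covE !XG.
have -> : dirderiv i X (ginner g i (frame a) (frame b)) p =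
    \sum_c X p 0 c * (connection c p *m g i p) a b
    + \sum_c X p 0 c * (connection c p *m g i p) b a.
  rewrite -big_split; apply: eq_bigr => c _ /=; rewrite -mulrDr; congr (_ * _).
  have := dmx_gcomp c ip => /matrixP/(_ a b); rewrite !mxE => <-.
  apply: (pd_ext (chart_open_cdom i)) ip => q iq.
  by rewrite ginner_frame /frame -rowE mxE.
have E u v : ginner g i (bracket i X (frame u)) (frame v) p =
    - (dmx i u X p *m g i p) 0 v.
  by rewrite ginner_frame bracket_frame mulNmx mxE.
rewrite [ginner _ _ (frame a) _ _]ginner_sym// !E.
ring.
Qed.

End LeviCivita.

(** * Totally geodesic maps *)

Section TotallyGeodesic.
Context {R : realType} {m n : nat} {M : manifold R m} {N : manifold R n}.
Context (g : metric M) (h : metric N) (F : M -> N) (i : chart M) (j : chart N).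
Implicit Types (X Y : M -> 'rV[R]_m) (p : M).

Let J := jac F i j.
Let D := cdom i `&` F @^-1` cdom j.

(** The connection matrices of the pullback to F^{-1}TN of the Levi-Civita
connection of h. *)
Definition pullback_connection (a : 'I_m) p : 'M[R]_n :=
  \sum_k J p a k *: connection h j k (F p).

Definition pullback_curvature (a b : 'I_m) p : 'M[R]_n :=
  \sum_k \sum_l (J p a k * J p b l) *: curvature h j k l (F p).

Lemma nabla_pullbackE X (V : M -> 'rV[R]_n) p :
  nabla_pullback h F i j X V p =
  \sum_a X p 0 a *: (dmx i a V p + V p *m pullback_connection a p).
Proof.
have E a : V p *m pullback_connection a p =
    \sum_k J p a k *: (V p *m connection h j k (F p)).
  by rewrite mulmx_sumr; apply: eq_bigr => k _; rewrite scalemxAr.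
under eq_bigr do rewrite E scalerDr.
rewrite big_split/=; apply/rowP => c; rewrite !mxE summxE; congr (_ + _).
  by apply: eq_bigr => a _; rewrite !mxE.
transitivity (
    \sum_k pushfwd F i j X p 0 k * (V p *m connection h j k (F p)) 0 c).
  apply: eq_bigr => k _; rewrite [X in _ = _ * X]mxE mulr_sumr.
  apply: eq_bigr => l _.
  by rewrite [connection _ _ _ _ _ _]mxE; ring.
rewrite summxE.
transitivity (
    \sum_k \sum_a X p 0 a * J p a k * (V p *m connection h j k (F p)) 0 c).
  by apply: eq_bigr => k _; rewrite mxE mulr_suml.
rewrite exchange_big/=; apply: eq_bigr => a _.
rewrite mxE summxE mulr_sumr; apply: eq_bigr => k _.
by rewrite -mulrA; congr (_ * _); rewrite [RHS]mxE.
Qed.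

Hypothesis smF : smooth_map F.

Let cD : chart_open i D.
Proof.
by apply: chart_openI; case: smF => cF _; apply: open_comp (cdom_open j) => x _.
Qed.

Let cj : chart_open j (cdom j). Proof. exact: chart_open_cdom. Qed.

Let FD p : D p -> cdom j (F p). Proof. by case. Qed.

Let sF : smooth_mx i D (fun q => cmap j (F q)).
Proof.
by apply: ((smooth_mxP (fun q => cmap j (F q)) cD).1 _); case: smF => _; apply.
Qed.

Let sJ : smooth_mx i D J. Proof. exact: (smooth_jac cD sF). Qed.

Let smooth_mx_cdom k l (A : M -> 'M[R]_(k, l)) :
  smooth_mx i (cdom i) A -> smooth_mx i D A.
Proof. by move=> sA u v; apply: smooth_inS (sA u v) => p []. Qed.

Let sconn a : smooth_mx i D (connection g i a).
Proof. exact/smooth_mx_cdom/smooth_connection. Qed.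

(** The derivatives of Y cancel out: only the covariant derivative of dF
remains. *)
Lemma second_fundamental_formE X Y p : smooth_mx i D Y -> D p ->
  second_fundamental_form g h F i j X Y p =
  \sum_a X p 0 a *: (Y p *m (dmx i a J p
    - (connection g i a p *m J p - J p *m pullback_connection a p))).
Proof.
move=> sY Dp.
rewrite /second_fundamental_form nabla_pullbackE /pushfwd nablaE mulmx_suml.
rewrite -sumrB; apply: eq_bigr => a _.
rewrite (dmxM cD)// -scalemxAl -scalerBr; congr (_ *: _).
rewrite !mulmxBr mulmxDl !mulmxA.
rewrite opprB opprD addrACA [_ - dmx _ _ _ _ *m _]addrAC subrr add0r.
by [].
Qed.

(** The differential of a totally geodesic map is parallel. The second
fundamental form being defined on globally defined fields, the vectors of the
coordinate frame are first extended to M. *)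
Lemma dmx_jac a p : totally_geodesic g h F -> D p ->
  dmx i a J p = connection g i a p *m J p - J p *m pullback_connection a p.
Proof.
move=> tg Dp; have [ip jp] := Dp; apply/eqP; rewrite -subr_eq0; apply/eqP.
apply/row_matrixP => b; rewrite row0.
have [X [c [c0 Xp]]] := vfield_through a ip.
have [Y [d [d0 Yp]]] := vfield_through b ip.
have sY : smooth_mx i D (Y i) by exact/smooth_mx_cdom/smooth_vcomp.
have := tg X Y i j p ip jp; rewrite second_fundamental_formE// Xp Yp.
under eq_bigr do rewrite mxE -scalerA.
rewrite -scaler_sumr sum_delta -scalemxAl -rowE => /eqP.
by rewrite !scaler_eq0 (negPf c0) (negPf d0) => /eqP.
Qed.

Hypothesis tgF : totally_geodesic g h F.

Let sOm a : smooth_mx i D (pullback_connection a).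
Proof.
apply: (smooth_mx_sum cD) => k; apply: (smooth_mxZ cD); first exact: sJ.
apply: (@smooth_mx_comp _ _ _ _ _ F i j D (cdom j)) => //.
exact: smooth_connection.
Qed.

Lemma dmx_pullback_connection a b p : D p ->
  dmx i a (pullback_connection b) p =
  \sum_l pd i a (fun q => J q b l) p *: connection h j l (F p)
  + \sum_k \sum_l (J p a k * J p b l) *: dmx j k (connection h j l) (F p).
Proof.
move=> Dp.
have sc l : smooth_mx i D (fun q => connection h j l (F q)).
  apply: (@smooth_mx_comp _ _ _ _ _ F i j D (cdom j)) => //.
  exact: smooth_connection.
have sZ l : smooth_mx i D (fun q => J q b l *: connection h j l (F q)).
  by apply: (smooth_mxZ cD).
rewrite (dmx_sum cD)// [X in _ = _ + X]exchange_big -big_split/=.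
apply: eq_bigr => l _; rewrite (dmxZ cD)//; congr (_ + _).
have -> : dmx i a (fun q => connection h j l (F q)) p =
    \sum_k J p a k *: dmx j k (connection h j l) (F p).
  apply: (@dmx_comp _ _ _ _ _ F i j D (cdom j)) => //.
  exact: smooth_connection.
by rewrite scaler_sumr; apply: eq_bigr => k _; rewrite scalerA mulrC.
Qed.

(** The curvature of the pullback connection is the pullback of the curvature:
the second derivatives of F that occur are symmetric and cancel out. *)
Lemma pullback_curvatureE a b p : D p ->
  pullback_curvature a b p =
  dmx i a (pullback_connection b) p - dmx i b (pullback_connection a) p
  + (pullback_connection b p *m pullback_connection a p
     - pullback_connection a p *m pullback_connection b p).
Proof.
move=> Dp; rewrite !dmx_pullback_connection//.
have mulE c d : pullback_connection c p *m pullback_connection d p =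
    \sum_k \sum_l (J p d k * J p c l) *:
      (connection h j l (F p) *m connection h j k (F p)).
  rewrite exchange_big/= mulmx_suml; apply: eq_bigr => l _.
  rewrite mulmx_sumr; apply: eq_bigr => k _.
  by rewrite -scalemxAl -scalemxAr scalerA mulrC.
rewrite !mulE.
have -> : \sum_l pd i b (fun q => J q a l) p *: connection h j l (F p) =
          \sum_l pd i a (fun q => J q b l) p *: connection h j l (F p).
  by apply: eq_bigr => l _; rewrite (pd_jac_sym cD sF).
rewrite opprD [X in _ = X + _]addrACA subrr add0r.
rewrite [X in _ - X + _]exchange_big [X in _ + (_ - X)]exchange_big/=.
rewrite -!sumrB -big_split/=; apply: eq_bigr => k _.
rewrite -!sumrB -big_split/=; apply: eq_bigr => l _.
by rewrite ![J p b l * _]mulrC -!scalerBr -scalerDr.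
Qed.

(** The Ricci identity for the parallel section dF: second derivatives of the
components of dF are symmetric. *)
Lemma curvature_jac a b p : D p ->
  curvature g i a b p *m J p = J p *m pullback_curvature a b p.
Proof.
move=> Dp; rewrite pullback_curvatureE// /curvature.
have E u v : dmx i u (dmx i v J) p =
    dmx i u (connection g i v) p *m J p
    + connection g i v p *m (connection g i u p *m J p
                             - J p *m pullback_connection u p)
    - ((connection g i u p *m J p - J p *m pullback_connection u p)
         *m pullback_connection v p
       + J p *m dmx i u (pullback_connection v) p).
  transitivity (dmx i u (fun q =>
      connection g i v q *m J q - J q *m pullback_connection v q) p).
    by apply: (dmx_ext cD) Dp => q Dq; exact: dmx_jac.
  have s1 : smooth_mx i D (fun q => connection g i v q *m J q).
    exact: (smooth_mxM cD).
  have s2 : smooth_mx i D (fun q => J q *m pullback_connection v q).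
    exact: (smooth_mxM cD).
  by rewrite (dmxB cD)// (dmxM cD)// (dmxM cD)// dmx_jac.
have := dmx_comm cD a b sJ Dp; rewrite !E.
move: (dmx i a (connection g i b) p) (dmx i b (connection g i a) p).
move: (connection g i a p) (connection g i b p) (J p).
move: (pullback_connection a p) (pullback_connection b p).
move: (dmx i a (pullback_connection b) p) (dmx i b (pullback_connection a) p).
move=> dO' dO O O' A B j0 dB dA /eqP; rewrite -subr_eq0 => /eqP H.
apply/eqP; rewrite -subr_eq0; apply/eqP; rewrite -[RHS]H.
rewrite !(mulmxDl, mulmxDr, mulNmx, mulmxN) !mulmxA.
move: (dB *m j0) (dA *m j0) (B *m A *m j0) (A *m B *m j0) (j0 *m dO')
  (j0 *m dO) (j0 *m O *m O') (j0 *m O' *m O) (B *m j0 *m O) (A *m j0 *m O').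
move=> x1 x2 x3 x4 x5 x6 x7 x8 x9 x10.
by apply/matrixP => u v; rewrite !mxE; ring.
Qed.

(** Differentiate F_*Z = Zt o F; as dF is parallel, F_* commutes with the
covariant derivative. *)
Lemma covariant_diff_lift (Z : vfield M) (Zt : vfield N) p :
  horizontal_lift g F Z Zt -> D p ->
  covariant_diff g i (Z i) p *m J p = J p *m covariant_diff h j (Zt j) (F p).
Proof.
move=> [_ ZZt] Dp; have [ip jp] := Dp.
have sZ : smooth_mx i D (Z i) by exact/smooth_mx_cdom/smooth_vcomp.
have rowE' a : row a (covariant_diff g i (Z i) p) =
    dmx i a (Z i) p + Z i p *m connection g i a p.
  by apply/rowP => c; rewrite !mxE.
have rowE'' k : row k (covariant_diff h j (Zt j) (F p)) =
    dmx j k (Zt j) (F p) + Zt j (F p) *m connection h j k (F p).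
  by apply/rowP => c; rewrite !mxE.
apply/row_matrixP => a; rewrite !row_mul rowE' [RHS]mulmx_sum_row.
under eq_bigr do rewrite rowE'' [row _ _ _ _]mxE scalerDr.
rewrite big_split/=.
have <- : dmx i a (fun q => Z i q *m J q) p =
    \sum_k J p a k *: dmx j k (Zt j) (F p).
  transitivity (dmx i a (Zt j \o F) p).
    by apply: (dmx_ext cD) Dp => q [iq jq]; exact: ZZt.
  by apply: (@dmx_comp _ _ _ _ _ F i j D (cdom j)) => //; exact: smooth_vcomp.
have <- : Zt j (F p) *m pullback_connection a p =
    \sum_k J p a k *: (Zt j (F p) *m connection h j k (F p)).
  by rewrite mulmx_sumr; apply: eq_bigr => k _; rewrite scalemxAr.
rewrite -(ZZt i j p ip jp) /pushfwd (dmxM cD)// dmx_jac//.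
rewrite mulmxDl mulmxBr !mulmxA -!addrA; congr (_ + _).
by rewrite addNr addr0.
Qed.

End TotallyGeodesic.

(** * Horizontal lifts and the soliton equation *)

Section HorizontalConformality.
Context {R : realType} {m n : nat} {M : manifold R m} {N : manifold R n}.
Context (g : metric M) (h : metric N) (F : M -> N) (lambda : M -> R).
Hypothesis hcF : horizontally_conformal_submersion g h F lambda.
Context (i : chart M) (j : chart N) (p : M).
Hypotheses (ip : cdom i p) (jp : cdom j (F p)).

Let J := jac F i j p.
Let G := invmx (g i p).

Let gG : g i p *m G = 1%:M. Proof. by rewrite mulmxV// gcomp_unit. Qed.

Let Gg : G *m g i p = 1%:M. Proof. by rewrite mulVmx// gcomp_unit. Qed.

Let GT : G^T = G. Proof. by rewrite trmx_inv gcomp_sym. Qed.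

Lemma dilation_neq0 : lambda p != 0.
Proof. by case: hcF => _ _ _ l0 _; exact: lt0r_neq0. Qed.

(** The horizontal space is the g-orthogonal of the kernel of dF, hence the
image of J^T G, the adjoint of dF. *)
Lemma horizontal_adjoint (w : 'rV[R]_n) :
  horizontal g F i j p (w *m J^T *m G).
Proof.
move=> v vJ; rewrite -[w *m _ *m _ *m _]mulmxA Gg mulmx1.
by rewrite -mulmxA -trmx_mul vJ trmx0 mulmx0.
Qed.

(** This is the Gram matrix, for the cometric G, of the columns of J, which are
independent because F is a submersion. *)
Lemma adjoint_unit : J^T *m G *m J \in unitmx.
Proof.
rewrite -row_free_unit -kermx_eq0; apply/rowV0P => w /sub_kermxP wA.
pose y := w *m J^T *m G.
have y0 : y = 0.
  apply/eqP; apply: contraT => yn0.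
  have := gcomp_pos g ip yn0.
  rewrite /y -[w *m _ *m _ *m g i p]mulmxA Gg mulmx1 !trmx_mul trmxK GT.
  have -> : w *m J^T *m (G *m (J *m w^T)) = w *m (J^T *m G *m J) *m w^T.
    by rewrite !mulmxA.
  by rewrite wA mul0mx mxE ltxx.
have : w *m J^T = 0.
  by rewrite -[LHS]mulmx1 -Gg mulmxA -/y y0 mul0mx.
case: hcF => -[_ /(_ i j p ip jp) fJ] _ _ _ _ wJ.
have : row_free J^T by rewrite /row_free mxrank_tr; exact: fJ.
by move=> /row_free_inj inj; apply: inj; rewrite mul0mx.
Qed.

(** Writing A for J^T G J, conformality on the horizontal vectors w J^T G reads
A h A = λ² A. *)
Lemma adjoint_conformal : J^T *m G *m J *m h j (F p) = (lambda p ^+ 2)%:M.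
Proof.
pose A := J^T *m G *m J.
have AT : A^T = A by rewrite /A !trmx_mul trmxK GT mulmxA.
suff E : A *m h j (F p) *m A = lambda p ^+ 2 *: A.
  have uA : A \in unitmx := adjoint_unit.
  by rewrite -[LHS](mulmxK uA) E -scalemxAl mulmxV// scalemx1.
apply/matrixP => a b.
pose da : 'rV[R]_n := delta_mx 0 a; pose db : 'rV[R]_n := delta_mx 0 b.
have entry (B : 'M[R]_n) : B a b = (da *m B *m db^T) 0 0.
  by rewrite /da /db trmx_delta -rowE -colE !mxE.
rewrite [LHS]entry [RHS]entry; congr (fun_of_matrix _ _ _).
have [_ _ _ _ /(_ i j p ip jp)] := hcF.
move=> /(_ _ _ (horizontal_adjoint da) (horizontal_adjoint db)).
have eJ (w : 'rV_n) : w *m J^T *m G *m J = w *m A by rewrite /A !mulmxA.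
rewrite -/J !eJ -[_ *m G *m g i p]mulmxA Gg mulmx1.
have -> : da *m (A *m h j (F p) *m A) *m db^T =
    da *m A *m h j (F p) *m (db *m A)^T by rewrite trmx_mul AT !mulmxA.
move=> ->; rewrite -scalemxAr -scalemxAl; congr (_ *: _).
by rewrite !trmx_mul trmxK GT /A !mulmxA.
Qed.

(** Row k is the horizontal lift of the k-th vector of the coordinate frame
of N. *)
Definition lift_mx : 'M[R]_(n, m) :=
  (lambda p ^+ 2)^-1 *: (h j (F p) *m J^T *m G).

Let l2_neq0 : lambda p ^+ 2 != 0.
Proof. by rewrite expf_neq0// dilation_neq0. Qed.

Lemma lift_mxK : lift_mx *m J = 1%:M.
Proof.
have := congr1 trmx adjoint_conformal.
rewrite !trmx_mul trmxK GT gcomp_sym// tr_scalar_mx => E.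
rewrite /lift_mx -scalemxAl -!mulmxA E -scalemx1 scalerA mulVf//.
by rewrite scale1r.
Qed.

Lemma lift_mx_metric :
  lift_mx *m g i p = (lambda p ^+ 2)^-1 *: (h j (F p) *m J^T).
Proof. by rewrite /lift_mx -scalemxAl -[_ *m G *m _]mulmxA Gg mulmx1. Qed.

Lemma lift_mx_conformal :
  lift_mx *m g i p *m lift_mx^T = (lambda p ^+ 2)^-1 *: h j (F p).
Proof.
rewrite lift_mx_metric -scalemxAl -mulmxA -trmx_mul lift_mxK trmx1.
by rewrite mulmx1.
Qed.

(** Used with B = ∇Z and C = ∇Zt. *)
Lemma lift_mx_form (B : 'M[R]_m) (C : 'M[R]_n) : B *m J = J *m C ->
  lift_mx *m (B *m g i p) *m lift_mx^T = (lambda p ^+ 2)^-1 *: (C *m h j (F p)).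
Proof.
move=> BJ.
have gS : g i p *m lift_mx^T = (lambda p ^+ 2)^-1 *: (J *m h j (F p)).
  rewrite -[g i p in LHS]gcomp_sym// -trmx_mul lift_mx_metric.
  by rewrite linearZ/= trmx_mul trmxK gcomp_sym.
rewrite -mulmxA -[B *m _ *m _]mulmxA gS -!scalemxAr.
by congr (_ *: _); rewrite [B *m _]mulmxA BJ !mulmxA lift_mxK mul1mx.
Qed.

(** The adjoint of B J = J C, since B and C are skew-adjoint and S is up to a
factor the adjoint of J. *)
Lemma lift_mx_skew (B : 'M[R]_m) (C : 'M[R]_n) : B *m J = J *m C ->
  B *m g i p = - (B *m g i p)^T -> C *m h j (F p) = - (C *m h j (F p))^T ->
  lift_mx *m B = C *m lift_mx.
Proof.
move=> BJ; rewrite !trmx_mul !gcomp_sym// => Bg Ch.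
have GB : G *m B = - (B^T *m G).
  have := congr1 (fun A => G *m A *m G) Bg.
  rewrite /= mulmxN mulNmx !mulmxA Gg mul1mx.
  by rewrite -[_ *m G in LHS]mulmxA gG mulmx1.
rewrite /lift_mx -scalemxAl -scalemxAr; congr (_ *: _).
rewrite -mulmxA GB mulmxN mulmxA -[_ *m J^T *m B^T]mulmxA -trmx_mul BJ trmx_mul.
by rewrite !mulmxA Ch !mulNmx.
Qed.

End HorizontalConformality.

Section Main.
Context {R : realType} {m n : nat} {M : manifold R m} {N : manifold R n}.
Context (g : metric M) (h : metric N) (F : M -> N) (lambda : M -> R).
Hypothesis hcF : horizontally_conformal_submersion g h F lambda.
Hypothesis tgF : totally_geodesic g h F.
Context (i : chart M) (j : chart N) (p : M).
Hypotheses (ip : cdom i p) (jp : cdom j (F p)).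

Let smF : smooth_map F. Proof. by case: hcF => -[]. Qed.

Let J := jac F i j p.
Let S := lift_mx g h F lambda i j p.

Lemma lift_mx_curvature a b :
  S *m curvature g i a b p = pullback_curvature h F i j a b p *m S.
Proof.
apply: (lift_mx_skew lambda ip jp); first exact: curvature_jac.
  exact: curvature_skew.
rewrite /pullback_curvature mulmx_suml linear_sum/= -sumrN.
apply: eq_bigr => k _; rewrite mulmx_suml linear_sum/= -sumrN.
apply: eq_bigr => l _; rewrite -scalemxAl linearZ/= -scalerN.
by congr (_ *: _); exact: curvature_skew.
Qed.

(** Ric^M(S e_k, S e_l) is the sum over a of the entries (l, a) of
S R^M(e_a, S e_k). Moving S to the right of the curvature gives S J = 1, and
the sum over the coordinates of M becomes a trace over N. *)
Lemma lift_mx_ricci : S *m ricci g i p *m S^T = ricci h j (F p).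
Proof.
have SJ : S *m J = 1%:M := lift_mxK hcF ip jp.
apply/matrixP => k l; rewrite ricciE//.
transitivity (\sum_a \sum_b S k b * (S *m curvature g i a b p) l a).
  rewrite exchange_big/= -mulmxA mxE; apply: eq_bigr => b _.
  rewrite -mulr_sumr; congr (_ * _); rewrite mxE.
  transitivity (\sum_c \sum_a S l c * curvature g i a b p c a).
    by apply: eq_bigr => c _; rewrite ricciE// mxE mulrC mulr_sumr.
  by rewrite exchange_big/=; apply: eq_bigr => a _; rewrite mxE.
have E a : \sum_b S k b *: pullback_curvature h F i j a b p =
    \sum_u J a u *: curvature h j u k (F p).
  transitivity (\sum_b \sum_u \sum_v (J a u * (S k b * J b v)) *:
      curvature h j u v (F p)).
    apply: eq_bigr => b _; rewrite scaler_sumr; apply: eq_bigr => u _.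
    rewrite scaler_sumr; apply: eq_bigr => v _.
    by rewrite scalerA mulrCA.
  rewrite exchange_big/=; apply: eq_bigr => u _.
  rewrite exchange_big/= (bigD1 k)//= [X in _ + X]big1 ?addr0.
    rewrite -scaler_suml -mulr_sumr; congr (_ *: _).
    have := SJ => /matrixP/(_ k k); rewrite !mxE eqxx => ->.
    by rewrite mulr1.
  move=> v vk; rewrite -scaler_suml -mulr_sumr.
  have := SJ => /matrixP/(_ k v); rewrite !mxE eq_sym (negPf vk) => ->.
  by rewrite mulr0 scale0r.
transitivity (
    \sum_a ((\sum_b S k b *: pullback_curvature h F i j a b p) *m S) l a).
  apply: eq_bigr => a _; rewrite mulmx_suml summxE; apply: eq_bigr => b _.
  by rewrite lift_mx_curvature -scalemxAl [RHS]mxE.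
transitivity (\sum_u (curvature h j u k (F p) *m (S *m J)) l u).
  under eq_bigr do rewrite E mulmx_suml summxE.
  rewrite exchange_big/=; apply: eq_bigr => u _.
  rewrite mulmxA mxE; apply: eq_bigr => a _.
  by rewrite -scalemxAl mxE mulrC.
by apply: eq_bigr => u _; rewrite SJ mulmx1.
Qed.

Lemma lift_mx_lie (Z : vfield M) (Zt : vfield N) : horizontal_lift g F Z Zt ->
  S *m lie_metric g i (Z i) p *m S^T =
  (lambda p ^+ 2)^-1 *: lie_metric h j (Zt j) (F p).
Proof.
move=> Zl; rewrite !lie_metricE// mulmxDr mulmxDl scalerDr.
have E := lift_mx_form hcF ip jp (covariant_diff_lift smF tgF Zl (conj ip jp)).
rewrite -/S in E; congr (_ + _); first exact: E.
have := congr1 trmx E; rewrite [X in X = _]trmx_mul [(S *m _)^T]trmx_mul trmxK.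
by rewrite -mulmxA => ->; rewrite linearZ.
Qed.

(** Evaluating the soliton equation on horizontal lifts gives an equation on
N in which Ric is a multiple of h. *)
Lemma lie_metric_lift (Z : vfield M) (Zt : vfield N) (mu c : R) :
  ricci_soliton g Z mu -> horizontal_lift g F Z Zt ->
  ricci h j (F p) = c *: h j (F p) ->
  lie_metric h j (Zt j) (F p) =
    (2 * - (c * lambda p ^+ 2 + mu)) *: h j (F p).
Proof.
move=> sol Zl ric.
have l2 : lambda p ^+ 2 != 0 by rewrite expf_neq0// (dilation_neq0 hcF).
have L := lift_mx_lie Zl; have Ric := lift_mx_ricci.
have H := lift_mx_conformal hcF ip jp; rewrite -/S in H.
move: (S) L Ric H => T L Ric H.
have := congr1 (fun A => T *m A *m T^T) (sol i p ip).
rewrite /= mulmx0 mul0mx !mulmxDr !mulmxDl -!scalemxAr -!scalemxAl.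
rewrite L Ric H ric {L Ric H}.
move: (lie_metric _ _ _ _) (h j (F p)) => L H /matrixP E.
apply/matrixP => u v; have := E u v; rewrite !mxE => {}E.
have : lambda p ^+ 2 * 2 * 0 = 0 :> R by rewrite mulr0.
rewrite -{1}E => {}E; apply/eqP; rewrite -subr_eq0 -{}E; apply/eqP.
have l0 := dilation_neq0 hcF p.
by field.
Qed.

End Main.

Lemma smooth_lie_metric (R : realType) n (N : manifold R n) (h : metric N)
    (X : vfield N) (j : chart N) :
  smooth_mx j (cdom j) (lie_metric h j (X j)).
Proof.
have cj := chart_open_cdom j.
have sX := smooth_vcomp j X; have sh := smooth_gcomp h j.
have scov : smooth_mx j (cdom j) (covariant_diff h j (X j)).
  move=> a c.
  have s : smooth_mx j (cdom j)
      (fun q => dmx j a (X j) q + X j q *m connection h j a q).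
    apply: (smooth_mxD cj); first exact: (smooth_dmx cj).
    by apply: (smooth_mxM cj) => //; exact: smooth_connection.
  by apply: (smooth_in_ext cj) (s 0 c) => q _; rewrite [RHS]mxE.
have sB : smooth_mx j (cdom j) (fun q => covariant_diff h j (X j) q *m h j q).
  exact: (smooth_mxM cj).
apply: (smooth_mx_ext cj) (smooth_mxD cj sB (smooth_mx_tr cj sB)) => q jq.
by rewrite lie_metricE.
Qed.

(** The conformal factor is half the quotient of two diagonal components, which
requires a coordinate direction to exist. *)
Lemma conformal_factor_smooth (R : realType) n (N : manifold R n)
    (h : metric N) (X : vfield N) (f : N -> R) : (0 < n)%N ->
  (forall (j : chart N) q, cdom j q ->
    lie_metric h j (X j) q = (2 * f q) *: h j q) ->
  smooth_fun f.
Proof.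
move=> n_gt0 Lf j; have cj := chart_open_cdom j; pose a := Ordinal n_gt0.
have h0 q : cdom j q -> 2 * h j q a a != 0.
  move=> jq; rewrite mulf_neq0 ?pnatr_eq0// lt0r_neq0//.
  have e0 : (delta_mx 0 a : 'rV[R]_n) != 0.
    by apply/eqP => /rowP/(_ a)/eqP; rewrite !mxE !eqxx oner_eq0.
  by have := gcomp_pos h jq e0; rewrite trmx_delta -rowE -colE !mxE.
have sL := smooth_lie_metric h X j; have sh := smooth_gcomp h j.
have s : smooth_in j (cdom j)
    (fun q => lie_metric h j (X j) q a a * (2 * h j q a a)^-1).
  apply: (smooth_inM cj); first exact: sL.
  apply: (smooth_inV cj) => //; apply: (smooth_inM cj); last exact: sh.
  exact: smooth_in_cst.
apply: (smooth_in_ext cj) s => q jq.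
have := h0 q jq; rewrite Lf// mxE mulf_eq0 negb_or => /andP[_ haa].
by field.
Qed.

Theorem theorem4p6 (R : realType) (m n : nat) (M : manifold R m)
    (N : manifold R n) (g : metric M) (h : metric N) (F : M -> N)
    (lambda : M -> R) (Z : vfield M) (Zt : vfield N) (mu : R)
    (N_connected : connected [set: N])
    (N_einstein : einstein h)
    (F_hcs : horizontally_conformal_submersion g h F lambda)
    (F_tg : totally_geodesic g h F)
    (Z_soliton : ricci_soliton g Z mu)
    (Z_horizontal : horizontal_field g F Z)
    (Z_lift : horizontal_lift g F Z Zt) :
  conformal_field h Zt.
Proof.
have [n0|n_gt0] := posnP n.
  exists (fun=> 0); split; first by move=> j k; exact: Ck_cst.
  move=> j q _; apply/matrixP => a.
  by have := ltn_ord a; rewrite [X in (_ < X)%N]n0.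
have [c ric] := N_einstein.
have [_ surjF _ _ _] := F_hcs.
have [s sK] := choice surjF.
pose f q := - (c * lambda (s q) ^+ 2 + mu).
have Lf (j : chart N) q : cdom j q ->
    lie_metric h j (Zt j) q = (2 * f q) *: h j q.
  move=> jq; have [i ip] := cdom_cover (s q).
  have jp : cdom j (F (s q)) by rewrite sK.
  have := lie_metric_lift F_hcs F_tg ip jp Z_soliton Z_lift (ric _ _ jp).
  by rewrite sK.
by exists f; split=> //; exact: conformal_factor_smooth Lf.
Qed.
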